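(* Let $n$ and $k$ be positive integers with $1\le k\le 2n+2$, let $\tau$ be in the upper half plane, and let $c_0,\ldots,c_{n+1}$ be the functions of $\tau$ defined in the context. Then $$\sum_{\substack{i=0\\2i\ge k-1}}^{n+1}\binom{2i}{k-1}c_i+\sum_{\substack{i=0\\2i\le k}}^{n+1}\binom{2n+2-2i}{2n+2-k}c_i=\begin{cases}c_{\frac{k-1}{2}},&k\text{ odd},\\ c_{\frac k2},&k\text{ even}.\end{cases}$$
   Context: For $m\ge1$ and $\tau$ in the upper half plane, $E_{2m}(\tau)=2\zeta(2m)+\frac{2(2\pi i)^{2m}}{(2m-1)!}\sum_{k\ge1}\sigma_{2m-1}(k)e^{2\pi ik\tau}$, where $\zeta$ is the Riemann zeta function and $\sigma_\ell(k)=\sum_{d\mid k}d^\ell$ (for $m\ge2$ this equals $\sum_{\gamma\in(\mathbb{Z}\tau+\mathbb{Z})\setminus\{0\}}\gamma^{-2m}$). For a positive integer $n$, define $$c_0=c_{n+1}=E_{2n+2}(\tau),\qquad c_j=-E_{2j}(\tau)E_{2n+2-2j}(\tau)-(\delta_{j,1}+\delta_{j,n})\frac{\pi i}{n}\frac{\partial E_{2n}(\tau)}{\partial\tau}\quad(1\le j\le n),$$ where $\delta_{i,j}$ is the Kronecker delta. *)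

(* Defs.v *)
From Stdlib Require Import Reals Arith List.
From Coquelicot Require Import Coquelicot.

Local Open Scope C_scope.

Definition Cexp (z : C) : C :=
  ((exp (Re z) * cos (Im z))%R, (exp (Re z) * sin (Im z))%R).

(* [Series] takes a default value on divergent series; every series below
   converges at the points where it is used. *)
Definition CSeries (a : nat -> C) : C :=
  (Series (fun k => Re (a k)), Series (fun k => Im (a k))).

(* The Riemann zeta function at an integer [s >= 2]. *)
Definition zeta (s : nat) : R := Series (fun k => / INR (S k) ^ s)%R.

Definition divisor_sigma (l k : nat) : nat :=
  list_sum (map (fun d => Nat.pow d l)
                (filter (fun d => Nat.eqb (Nat.modulo k d) 0) (seq 1 k))).

(* [eisenstein m] is E_{2m}, indexed by half the weight, for [m >= 1].
   The series over k >= 1 is indexed from 0, with k replaced by [S k]. *)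
Definition eisenstein (m : nat) (tau : C) : C :=
  RtoC (2 * zeta (2 * m))
  + 2 * (2 * RtoC PI * Ci) ^ (2 * m) / RtoC (INR (fact (2 * m - 1)))
    * CSeries (fun k =>
        RtoC (INR (divisor_sigma (2 * m - 1) (S k)))
        * Cexp (2 * RtoC PI * Ci * RtoC (INR (S k)) * tau)).

Definition kronecker (i j : nat) : C := if Nat.eqb i j then 1 else 0.

(* [C_derive] takes the limit of the difference quotient along the real
   direction only; this is the complex derivative because [eisenstein n] is
   holomorphic on the upper half plane. *)
Definition coef (n : nat) (tau : C) (j : nat) : C :=
  if (Nat.eqb j 0 || Nat.eqb j (n + 1))%bool then eisenstein (n + 1) tau
  else
    - (eisenstein j tau * eisenstein (n + 1 - j) tau)
    - (kronecker j 1 + kronecker j n)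
      * (RtoC PI * Ci / RtoC (INR n)) * C_derive (eisenstein n) tau.

(* Stdlib's binomial coefficient, whose name [C] Coquelicot reuses for the
   complex numbers. It does not vanish for [n < k]; it is only used below for
   [k <= n]. *)
Definition binom (n k : nat) : C := RtoC (Binomial.C n k).

(* Main.v *)
Require Import Defs.
From Stdlib Require Import Reals Arith List Lra Lia.
From Coquelicot Require Import Coquelicot.
From mathcomp Require all_boot all_order all_algebra ring zify Rstruct.

(** Divide [c_j] by [(2 pi i)^(2n+2)] and write [E_2j = (2 pi i)^(2j) e_j], with
    the convention [e_0 = -1].  Since [(pi i / n) dE_2n/dtau] is
    [(2 pi i)^(2n+2)] times the series [D] with q-coefficients
    [2/(2n)! l sigma_(2n-1)(l)], all the normalised coefficients, the two
    extreme ones included, have the single shape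
    [- e_j e_(n+1-j) - (delta_(j,1) + delta_(j,n)) D], and this is a power series
    in [q] with real coefficients.  Both sides of the statement being linear in
    the [c_j], it is enough to prove it for each power of [q] separately.

    For fixed [q^l] the identities, over all [k], are the coefficients of one
    functional equation for [f(x,y) = sum_j c_j x^(2j-1) y^(2n+1-2j)], namely
    [f(x,y) = f(x+y,y) + f(x,x+y)] ([lewis_coef]).  The part of [f] coming from
    the derivative turns [f(x,y) - f(x+y,y) - f(x,x+y)] into a multiple of
    [x^2n + y^2n + (x+y)^2n], so what has to be shown is the degree [2n] part of
    a Fay identity for [S(x) = sum_j e_j x^(2j-1)], the logarithmic derivative of
    a theta function:
    [S(x) S(y) - S(x+y) (S(x) + S(y)) = W(x) + W(y) + W(x+y)].

    - For [l = 0], [S(x)] is [- coth(x/2) / 2] and the identity is the addition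
      formula of [coth] ([even_series_lewis]).
    - For [l > 0], a product of two coefficients of positive index is a sum of
      [(ax+by)^2n - (ax-by)^2n] over the positive solutions of [ac + bd = l].  One
      step of the Euclidean algorithm, [(a,b,c,d) -> (a,a+b,c-d,d)], permutes
      these solutions up to boundary terms, and nearly everything cancels
      ([quads_even_identity]).  The boundary is a sum over the divisors of [l],
      which is compensated by the products with the constant terms: these are
      Euler-Maclaurin sums along arithmetic progressions ([const_kernel_steps]).

    The only arithmetic input is that the constant terms
    [b_j = 2 zeta(2j) / (2 pi i)^(2j)] are Bernoulli numbers up to a factor.  This
    follows from [zeta(2) = pi^2/6] ([zeta_2]) and Euler's convolution formula
    ([zeta_convolution]): together they say that [sum_j b_j x^(2j-1)] satisfies
    the Riccati equation of [- coth(x/2) / 2], whence the linear recurrence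
    ([bernoulli_recurrence]).  It remains to check that evaluation at
    [q = exp(2 pi i tau)] is linear and multiplicative on absolutely summable
    coefficient sequences, and that q-series may be differentiated term by
    term. *)

(** * Real coefficient sequences *)

Local Open Scope R_scope.

(** The q-coefficients of [E_2m / (2 pi i)^(2m)], once [b m] is its constant term.
    The value at [m = 0] makes [e_0] a constant, so that the extreme coefficients
    [c_0] and [c_(n+1)] are products like the others. *)
Definition eis_seq (b : nat -> R) (m l : nat) : R :=
  (if Nat.eqb l 0 then b m else if Nat.eqb m 0 then 0
   else 2 / INR (fact (2 * m - 1)) * INR (divisor_sigma (2 * m - 1) l))%R.

(** [(pi i / n) dE_2n/dtau] divided by [(2 pi i)^(2n+2)]. *)
Definition deriv_seq (n l : nat) : R :=
  (2 / INR (fact (2 * n)) * (INR l * INR (divisor_sigma (2 * n - 1) l)))%R.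

Definition indicator (i j : nat) : R := if Nat.eqb i j then 1%R else 0%R.

(** The q-coefficients of [c_j / (2 pi i)^(2n+2)], by one formula for all
    [0 <= j <= n + 1]. *)
Definition coef_seq (b : nat -> R) (n j l : nat) : R :=
  (- sum_f_R0 (fun i => eis_seq b j i * eis_seq b (n + 1 - j) (l - i)) l
   - (indicator j 1 + indicator j n) * deriv_seq n l)%R.

Local Close Scope R_scope.

Module Identities.
Import all_boot all_order all_algebra ring zify Rstruct.
Set Implicit Arguments. Unset Strict Implicit. Unset Printing Implicit Defensive.
Import GRing.Theory Num.Theory.
Local Open Scope ring_scope.

(** * Sums over the solutions of a c + b d = l *)

(** Divisors [a] of [i] and [b] of [j], kept together with their cofactors. *)
Definition divpairs (i j : nat) : seq ((nat * nat) * (nat * nat)) :=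
  [seq ((a, b), (i %/ a, j %/ b)%N) | a <- divisors i, b <- divisors j].

(** The positive solutions [((a, b), (c, d))] of [a c + b d = l], listed by the
    value of [a c] so that a convolution of divisor sums is literally a sum over
    this list. *)
Definition quads (l : nat) : seq ((nat * nat) * (nat * nat)) :=
  [seq p | i <- index_iota 1 l, p <- divpairs i (l - i)].

Lemma mem_divpairs i j a b c d : (0 < i)%N -> (0 < j)%N ->
  (((a, b), (c, d)) \in divpairs i j) = ((a * c == i) && (b * d == j))%N.
Proof.
move=> i0 j0; apply/allpairsP/andP => [[[a' b'] /= []]|[/eqP Hi /eqP Hj]].
  rewrite -!dvdn_divisors // => /divnK Ha /divnK Hb [-> -> -> ->].
  by rewrite mulnC Ha mulnC Hb !eqxx.
have a0 : (0 < a)%N by case: a Hi i0 => // <-.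
have b0 : (0 < b)%N by case: b Hj j0 => // <-.
exists (a, b); rewrite -!dvdn_divisors //= -Hi -Hj !dvdn_mulr //.
by rewrite !mulKn.
Qed.

Lemma mem_quads l a b c d : (((a, b), (c, d)) \in quads l) =
  [&& 0 < a, 0 < b, 0 < c, 0 < d & a * c + b * d == l]%N.
Proof.
apply/allpairsPdep/idP => [[i [p []]]|/and5P[a0 b0 c0 d0 /eqP El]].
  rewrite mem_index_iota => /andP[i0 il] + E; rewrite -{}E mem_divpairs.
  - by move=> /andP[/eqP Hi /eqP Hj]; nia.
  - by [].
  - by rewrite subn_gt0.
exists (a * c)%N, ((a, b), (c, d)); split => //.
  by rewrite mem_index_iota; nia.
by rewrite mem_divpairs; nia.
Qed.

Lemma uniq_divpairs i j : uniq (divpairs i j).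
Proof.
apply: allpairs_uniq; rewrite ?divisors_uniq // => -[a b] [a' b'] _ _.
by case=> -> -> _ _.
Qed.

Lemma uniq_quads l : uniq (quads l).
Proof.
apply: allpairs_uniq_dep; rewrite ?iota_uniq //.
  by move=> i _; apply: uniq_divpairs.
move=> /= [i p] [j p'] /allpairsPdep[i1 [p1 [+ + [E1 E2]]]].
move=> + + /allpairsPdep[j1 [p2 [+ + [E3 E4]]]].
rewrite /tagged /= in E2 E4 *; subst => /=.
move: p1 p2 => [[a b] [c d]] [[a' b'] [c' d']].
rewrite !mem_index_iota => H1 + H2 + [? ? ? ?]; subst.
rewrite !mem_divpairs; try lia.
by move=> /andP[/eqP -> _] /andP[/eqP -> _].
Qed.

Section Sums.
Variable F : zmodType.
Implicit Types G : nat -> nat -> F.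

Lemma quads_convolution G l :
  \sum_(1 <= i < l) \sum_(a <- divisors i) \sum_(b <- divisors (l - i)) G a b
  = \sum_(p <- quads l) G p.1.1 p.1.2.
Proof.
by rewrite big_allpairs_dep; apply: eq_bigr => i _; rewrite big_allpairs_dep.
Qed.

(** Reindexing along mutually inverse maps between two filtered lists; only the
    values on the lists matter, so no finite type of solutions is needed. *)
Lemma big_seq_bij (T T' : eqType) (s : seq T) (s' : seq T') (f : T -> T')
    (g : T' -> T) (P : pred T) (P' : pred T') (K : T' -> F) :
  uniq s -> uniq s' ->
  (forall x, x \in s -> P x -> [&& f x \in s', P' (f x) & g (f x) == x]) ->
  (forall y, y \in s' -> P' y -> [&& g y \in s, P (g y) & f (g y) == y]) ->
  \sum_(x <- s | P x) K (f x) = \sum_(y <- s' | P' y) K y.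
Proof.
move=> us us' Hf Hg; rewrite -big_filter -(big_map f xpredT) -[RHS]big_filter.
apply: perm_big; apply: uniq_perm; rewrite ?filter_uniq //.
  rewrite map_inj_in_uniq ?filter_uniq // => x y.
  rewrite !mem_filter => /andP[Px sx] /andP[Py sy] E.
  have /and3P[_ _ /eqP <-] := Hf _ sx Px.
  by have /and3P[_ _ /eqP <-] := Hf _ sy Py; rewrite E.
move=> y; apply/mapP/idP => [[x + ->]|].
  by rewrite !mem_filter => /andP[Px sx]; have /and3P[-> ->] := Hf _ sx Px.
rewrite mem_filter => /andP[Py sy]; have /and3P[sx Px /eqP E] := Hg _ sy Py.
by exists (g y); rewrite // mem_filter Px.
Qed.

(** The symmetry exchanging [(a, c)] with [(b, d)]. *)
Lemma quads_swap (P : nat -> nat -> nat -> nat -> bool) G l :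
  \sum_(p <- quads l | P p.1.1 p.1.2 p.2.1 p.2.2) G p.1.1 p.1.2
  = \sum_(p <- quads l | P p.1.2 p.1.1 p.2.2 p.2.1) G p.1.2 p.1.1.
Proof.
pose f (p : (nat * nat) * (nat * nat)) := ((p.1.2, p.1.1), (p.2.2, p.2.1)).
symmetry; apply: (@big_seq_bij _ _ _ _ f f _ _ (fun p => G p.1.1 p.1.2));
  rewrite ?uniq_quads // => -[[a b] [c d]]; rewrite !mem_quads /= => H ->;
  by rewrite eqxx andbT /= addnC; case/and5P: H => -> -> -> -> ->.
Qed.

(** The Euclidean step: [a c + b d = a (c - d) + (a + b) d] maps the solutions
    with [c > d] bijectively onto those with [a < b]. *)
Lemma quads_euclid_gt G l :
  \sum_(p <- quads l | (p.2.2 < p.2.1)%N) G p.1.1 p.1.2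
  = \sum_(p <- quads l | (p.1.1 < p.1.2)%N) G p.1.1 (p.1.2 - p.1.1)%N.
Proof.
pose f (p : (nat * nat) * (nat * nat)) :=
  ((p.1.1, p.1.1 + p.1.2), (p.2.1 - p.2.2, p.2.2))%N.
pose g (p : (nat * nat) * (nat * nat)) :=
  ((p.1.1, p.1.2 - p.1.1), (p.2.1 + p.2.2, p.2.2))%N.
pose K (p : (nat * nat) * (nat * nat)) := G p.1.1 (p.1.2 - p.1.1)%N.
transitivity (\sum_(p <- quads l | (p.2.2 < p.2.1)%N) K (f p)).
  by apply: eq_bigr => -[[a b] [c d]] _; rewrite /K /f /= addKn.
apply: (@big_seq_bij _ _ _ _ f g); rewrite ?uniq_quads //.
- move=> [[a b] [c d]]; rewrite /f /g mem_quads /= => H H'; rewrite mem_quads /=.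
  rewrite addKn subnK; last exact: ltnW.
  rewrite eqxx andbT; apply/andP; split; last by lia.
  case/and5P: H => a0 b0 c0 d0 /eqP <-.
  by have := leq_mul (leqnn a) (ltnW H'); rewrite mulnBr mulnDl; lia.
- move=> [[a b] [c d]]; rewrite /f /g mem_quads /= => H H'; rewrite mem_quads /=.
  rewrite addnK subnKC; last exact: ltnW.
  rewrite eqxx andbT; apply/andP; split; last by lia.
  case/and5P: H => a0 b0 c0 d0 /eqP <-.
  by have := leq_mul (ltnW H') (leqnn d); rewrite mulnBl mulnDr; lia.
Qed.

Lemma quads_euclid_lt G l :
  \sum_(p <- quads l | (p.2.1 < p.2.2)%N) G p.1.1 p.1.2
  = \sum_(p <- quads l | (p.1.2 < p.1.1)%N) G (p.1.1 - p.1.2)%N p.1.2.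
Proof.
rewrite (quads_swap (fun a b c d => (c < d)%N)) /=.
rewrite (quads_euclid_gt (fun a b => G b a)).
by rewrite (quads_swap (fun a b c d => (a < b)%N) (fun a b => G (b - a)%N a)).
Qed.

Lemma big_trichotomy (T : Type) (s : seq T) (u v : T -> nat) (K : T -> F) :
  \sum_(p <- s) K p = \sum_(p <- s | (u p < v p)%N) K p
    + \sum_(p <- s | u p == v p) K p + \sum_(p <- s | (v p < u p)%N) K p.
Proof.
rewrite (bigID (fun p => (u p < v p)%N)) /= -addrA; congr (_ + _).
rewrite (bigID (fun p => u p == v p)) /=.
by congr (_ + _); apply: eq_bigl => p; lia.
Qed.

(** Both Euclidean steps at once; the solutions with [c = d] admit neither. *)
Lemma quads_euclid G l :
  \sum_(p <- quads l) G p.1.1 p.1.2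
  = \sum_(p <- quads l | (p.1.1 < p.1.2)%N) G p.1.1 (p.1.2 - p.1.1)%N
    + \sum_(p <- quads l | p.2.1 == p.2.2) G p.1.1 p.1.2
    + \sum_(p <- quads l | (p.1.2 < p.1.1)%N) G (p.1.1 - p.1.2)%N p.1.2.
Proof.
rewrite (big_trichotomy _ (fun p => p.2.2) (fun p => p.2.1)).
rewrite quads_euclid_gt quads_euclid_lt; congr (_ + _ + _).
by apply: eq_bigl => p; rewrite eq_sym.
Qed.

Lemma sum_mulrn_iota (x : F) m : \sum_(1 <= c < m) x = x *+ m.-1.
Proof. by rewrite sumr_const_nat subn1. Qed.

(** [a (c + d) = l] leaves [l/a - 1] choices for the pair [(c, d)]. *)
Lemma quads_equal_divisors (K : nat -> F) l :
  \sum_(p <- quads l | p.1.1 == p.1.2) K p.1.1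
  = \sum_(d <- divisors l) K d *+ (l %/ d).-1.
Proof.
case: (posnP l) => [->|l0]; first by rewrite /quads big_nil big_seq1.
pose s := [seq (d, c) | d <- divisors l, c <- index_iota 1 (l %/ d)].
transitivity (\sum_(x <- s) K x.1); last first.
  by rewrite big_allpairs_dep; apply: eq_bigr => d _; rewrite -sum_mulrn_iota.
pose f (p : (nat * nat) * (nat * nat)) := (p.1.1, p.2.1).
pose g (x : nat * nat) := ((x.1, x.1), (x.2, l %/ x.1 - x.2))%N.
have mem_s d c : ((d, c) \in s) = [&& d %| l, 0 < c & c < l %/ d]%N.
  apply/allpairsPdep/idP => [[d' [c' [+ + [-> ->]]]]|/andP[dl cl]].
    by rewrite -dvdn_divisors // mem_index_iota => -> ->.
  by exists d, c; rewrite -dvdn_divisors // mem_index_iota.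
apply: (@big_seq_bij _ _ _ _ f g _ _ (fun x => K x.1)); rewrite ?uniq_quads //.
- apply: allpairs_uniq_dep => [|d _|]; rewrite ?divisors_uniq ?iota_uniq //.
  by move=> [d c] [d' c'] _ _ [-> ->].
- move=> [[a b] [c d]]; rewrite mem_quads => /and5P[a0 b0 c0 d0 /eqP El] /= /eqP Eb.
  rewrite /f /g mem_s -El -Eb -mulnDr dvdn_mulr // mulKn //= addKn !eqxx.
  by rewrite c0 -addn1 leq_add2l d0.
- move=> [d c]; rewrite mem_s => /and3P[dl c0 cl] _ /=.
  rewrite mem_quads /= -mulnDr subnKC; last exact: ltnW.
  have d0 := dvdn_gt0 l0 dl.
  by rewrite mulnC divnK // !eqxx d0 c0 subn_gt0 cl.
Qed.

(** [(a + b) c = l]: the sum [a + b] runs over the divisors of [l]. *)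
Lemma quads_diag_divisors G l :
  \sum_(p <- quads l | p.2.1 == p.2.2) G p.1.1 p.1.2
  = \sum_(d <- divisors l) \sum_(1 <= a < d) G a (d - a)%N.
Proof.
case: (posnP l) => [->|l0]; first by rewrite /quads big_nil big_seq1 big_geq.
pose s := [seq (d, a) | d <- divisors l, a <- index_iota 1 d].
transitivity (\sum_(x <- s) G x.2 (x.1 - x.2)%N); last by rewrite big_allpairs_dep.
pose f (p : (nat * nat) * (nat * nat)) := (p.1.1 + p.1.2, p.1.1)%N.
pose g (x : nat * nat) := ((x.2, x.1 - x.2), (l %/ x.1, l %/ x.1))%N.
have mem_s d a : ((d, a) \in s) = [&& d %| l, 0 < a & a < d]%N.
  apply/allpairsPdep/idP => [[d' [c' [+ + [-> ->]]]]|/andP[dl cl]].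
    by rewrite -dvdn_divisors // mem_index_iota => -> ->.
  by exists d, a; rewrite -dvdn_divisors // mem_index_iota.
pose K (x : nat * nat) := G x.2 (x.1 - x.2)%N.
transitivity (\sum_(p <- quads l | p.2.1 == p.2.2) K (f p)).
  by apply: eq_bigr => -[[a b] [c d]] _; rewrite /K /f /= addKn.
apply: (@big_seq_bij _ _ _ _ f g); rewrite ?uniq_quads //.
- apply: allpairs_uniq_dep => [|d _|]; rewrite ?divisors_uniq ?iota_uniq //.
  by move=> [d c] [d' c'] _ _ [-> ->].
- move=> [[a b] [c d]]; rewrite mem_quads => /and5P[a0 b0 c0 d0 /eqP El] /= /eqP Ec.
  rewrite /f /g mem_s -El -Ec -mulnDl dvdn_mulr // mulKn; last by rewrite addn_gt0 a0.
  by rewrite /= addKn !eqxx a0 -addn1 leq_add2l b0.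
- move=> [d a]; rewrite mem_s => /and3P[dl a0 al] _ /=.
  rewrite mem_quads /= -mulnDl subnKC; last exact: ltnW.
  have d0 := dvdn_gt0 l0 dl.
  by rewrite mulnC divnK // !eqxx a0 subn_gt0 al divn_gt0 // dvdn_leq //= /f /= subnKC ?eqxx // ltnW.
Qed.
End Sums.

Section EvenIdentity.
Variables (F : comNzRingType) (H : F -> F) (x y : F).
Hypothesis H_even : forall z, H (- z) = H z.

(** The left-hand side is the three-term operator applied to
    [H(a x + b y) - H(a x - b y)].  After a Euclidean step on the terms
    [H(a x - b y)], [H(a x + (a + b) y)] and [H((a + b) x + b y)], each resulting
    sum over [a < b] or [a > b] occurs twice with opposite signs, evenness of [H]
    and the swap symmetry being used to match them; only the solutions with
    [a = b] or [c = d] survive. *)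
Lemma quads_even_identity l :
  \sum_(p <- quads l) (let a := p.1.1%:R in let b := p.1.2%:R in
     (H (a * x + b * y) - H (a * x - b * y))
     - (H (a * (x + y) + b * y) - H (a * (x + y) - b * y))
     - (H (a * x + b * (x + y)) - H (a * x - b * (x + y))))
  = \sum_(d <- divisors l) ((H (d%:R * (x + y)) + H (d%:R * x) + H (d%:R * y))
        *+ (l %/ d).-1
      - \sum_(1 <= a < d) (H (a%:R * x + d%:R * y)
          + H (d%:R * x + (d - a)%:R * y) + H (a%:R * x - (d - a)%:R * y))).
Proof.
pose G0p (a b : nat) := H (a%:R * x + b%:R * y).
pose G0m (a b : nat) := H (a%:R * x - b%:R * y).
pose G1p (a b : nat) := H (a%:R * x + (a + b)%:R * y).
pose G1m (a b : nat) := H (a%:R * x + (a%:R - b%:R) * y).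
pose G2p (a b : nat) := H ((a + b)%:R * x + b%:R * y).
pose G2m (a b : nat) := H ((a%:R - b%:R) * x - b%:R * y).
pose U (K : nat -> nat -> F) := \sum_(p <- quads l) K p.1.1 p.1.2.
transitivity (U G0p - U G0m - (U G1p - U G1m) - (U G2p - U G2m)).
  rewrite /U -!sumrB; apply: eq_bigr => -[[a b] cd] _ /=.
  rewrite /G0p /G0m /G1p /G1m /G2p /G2m !natrD.
  by congr (_ - (H _ - H _) - (H _ - H _)); ring.
pose Dg (K : nat -> nat -> F) := \sum_(p <- quads l | p.2.1 == p.2.2) K p.1.1 p.1.2.
pose Lt (K : nat -> nat -> F) := \sum_(p <- quads l | (p.1.1 < p.1.2)%N) K p.1.1 p.1.2.
pose Gt (K : nat -> nat -> F) := \sum_(p <- quads l | (p.1.2 < p.1.1)%N) K p.1.1 p.1.2.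
pose Eq (K : nat -> nat -> F) := \sum_(p <- quads l | p.1.1 == p.1.2) K p.1.1 p.1.2.
have U_split K : U K = Lt K + Eq K + Gt K by apply: big_trichotomy.
have Lt_swap K : Lt K = Gt (fun a b => K b a).
  exact: (quads_swap (fun a b _ _ => (a < b)%N) K).
have eqLt K K' : (forall a b, (a < b)%N -> K a b = K' a b) -> Lt K = Lt K'.
  by move=> E; apply: eq_bigr => -[[a b] cd]; apply: E.
have eqGt K K' : (forall a b, (b < a)%N -> K a b = K' a b) -> Gt K = Gt K'.
  by move=> E; apply: eq_bigr => -[[a b] cd]; apply: E.
have euclid K : U K = Lt (fun a b => K a (b - a)%N) + Dg K
    + Gt (fun a b => K (a - b)%N b) by apply: quads_euclid.
have U_G0m : U G0m = Lt G1m + Dg G0m + Gt G2m.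
  rewrite euclid; congr (_ + _ + _).
    by apply: eqLt => a b ab; rewrite /G0m /G1m natrB ?(ltnW ab) //; congr H; ring.
  by apply: eqGt => a b ab; rewrite /G0m /G2m natrB ?(ltnW ab) //; congr H; ring.
have U_G1p : U G1p = Lt G0p + Dg G1p + Lt G2m.
  rewrite euclid; congr (_ + _ + _).
    by apply: eqLt => a b ab; rewrite /G0p /G1p subnKC // ltnW.
  rewrite Lt_swap; apply: eqGt => a b ab; rewrite /G1p /G2m subnK ?(ltnW ab) //.
  by rewrite natrB ?(ltnW ab) // -H_even; congr H; ring.
have U_G2p : U G2p = Gt G1m + Dg G2p + Gt G0p.
  rewrite euclid; congr (_ + _ + _).
    rewrite Lt_swap; apply: eqGt => a b ab.
    by rewrite /G2p /G1m subnKC ?natrB ?(ltnW ab).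
  by apply: eqGt => a b ab; rewrite /G2p /G0p subnK // ltnW.
have -> : U G0p - U G0m - (U G1p - U G1m) - (U G2p - U G2m)
    = (Eq G0p + Eq G1m + Eq G2m) - (Dg G1p + Dg G2p + Dg G0m).
  by rewrite U_G0m U_G1p U_G2p !U_split; ring.
rewrite sumrB; congr (_ - _).
  rewrite -quads_equal_divisors /Eq -!big_split /=.
  apply: eq_bigr => -[[a b] cd] /= /eqP <-; rewrite /G0p /G1m /G2m !subrr !mul0r addr0 add0r H_even.
  by rewrite mulrDr.
rewrite /Dg !quads_diag_divisors -!big_split /=; apply: eq_bigr => d _.
rewrite -!big_split /=; apply: eq_big_nat => a /andP[_ ad].
by rewrite /G1p /G2p /G0m subnKC // ltnW.
Qed.
End EvenIdentity.

(** * Products of q-expansions and the three-term operator *)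

Section Period.
Variable F : numFieldType.
Implicit Types (x y w : F) (u v c : nat -> F) (f : F -> F -> F).

(** The monomial [u_j x^(2j-1)], written with a division because the exponent is
    [-1] for [j = 0]. *)
Definition laurent u x j := u j * x ^+ (2 * j) / x.

(** The part of total degree [2n] of the product of the Laurent series of [u] in
    [x] and of [v] in [y]. *)
Definition prod_part n u v x y :=
  \sum_(j < n.+2) laurent u x j * laurent v y (n.+1 - j).

(** The defect in the three-term equation of period functions. *)
Definition lewis f x y := f x y - f (x + y) y - f x (x + y).

Lemma prod_part_sym n u v x y : prod_part n u v x y = prod_part n v u y x.
Proof.
rewrite /prod_part (reindex_inj rev_ord_inj) /=; apply: eq_bigr => j _.
by rewrite subSS subKn 1?mulrC // -ltnS ltn_ord.
Qed.

Lemma factr_neq0 m : m`!%:R != 0 :> F.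
Proof. by rewrite pnatr_eq0 -lt0n fact_gt0. Qed.

(** Binomial theorem in divided powers: the degree [m] part of
    [exp(x + y) = exp x exp y]. *)
Lemma exprD_fact x y m : (x + y) ^+ m / m`!%:R
  = \sum_(p < m.+1) x ^+ p / p`!%:R * (y ^+ (m - p) / (m - p)`!%:R).
Proof.
rewrite addrC exprDn mulr_suml; apply: eq_bigr => p _.
have lepm : (p <= m)%N by rewrite -ltnS.
have E : m`!%:R = 'C(m, p)%:R * (p`!%:R * (m - p)`!%:R) :> F.
  by rewrite -!natrM bin_fact.
rewrite E -mulr_natr.
have := factr_neq0 m; rewrite E mulf_eq0 mulf_eq0 !negb_or => /and3P[c0 p0 q0].
by field; rewrite c0 p0 q0.
Qed.

Lemma sum_odd_terms (G : nat -> F) n :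
  \sum_(m < n.*2.+1) (G m - (-1) ^+ m * G m) = 2 * \sum_(k < n) G k.*2.+1.
Proof.
elim: n => [|n IHn].
  by rewrite big_ord_recl !big_ord0 mulr0 addr0 expr0 mul1r subrr.
rewrite doubleS 2!big_ord_recr /= IHn big_ord_recr /= mulrDr.
have s1 : (-1) ^+ n.*2 = 1 :> F by rewrite -signr_odd odd_double.
rewrite [_ ^+ n.*2.+2]exprS [_ ^+ n.*2.+1]exprS s1.
by move: (G _) (G _) (\sum_(k < n) _) => u v w; ring.
Qed.

(** The degree [2n] part of [cosh(x + y) - cosh(x - y) = 2 sinh x sinh y]. *)
Lemma expr_odd_part x y n :
  (x + y) ^+ (2 * n) / (2 * n)`!%:R - (x - y) ^+ (2 * n) / (2 * n)`!%:R
  = 2 * \sum_(k < n) x ^+ k.*2.+1 / k.*2.+1`!%:R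
          * (y ^+ (n - k.+1).*2.+1 / (n - k.+1).*2.+1`!%:R).
Proof.
rewrite mul2n ![x + _]addrC !exprD_fact -sumrB.
pose G m := y ^+ m / m`!%:R * (x ^+ (n.*2 - m) / (n.*2 - m)`!%:R).
transitivity (\sum_(m < n.*2.+1) (G m - (-1) ^+ m * G m)).
  by apply: eq_bigr => m _; rewrite (exprNn y) /G; ring.
rewrite sum_odd_terms (reindex_inj rev_ord_inj) /=; congr (_ * _).
apply: eq_bigr => k _; rewrite /G mulrC.
have kn := ltn_ord k.
by have -> : (n.*2 - (n - k.+1).*2.+1 = k.*2.+1)%N by lia.
Qed.

Section Coefficients.
Variable b : nat -> F.

(** The same coefficients as [eis_seq], over an arbitrary field and with the
    power [l] of [q] first, since [l] is fixed while [j] varies. *)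
Definition eis_coef l j : F :=
  if l == 0%N then b j else if j == 0%N then 0 else
  2 / (2 * j).-1`!%:R * \sum_(d <- divisors l) d%:R ^+ (2 * j).-1.

Lemma laurent_eis0 l x : (0 < l)%N -> laurent (eis_coef l) x 0 = 0.
Proof. by case: l => // l _; rewrite /laurent /eis_coef /= !mul0r. Qed.

(** For [l > 0] the series [sum_j e_j(l) x^(2j-1)] is [2 sum_(d | l) sinh(d x)]. *)
Lemma laurent_eisS l x j : (0 < l)%N -> x != 0 ->
  laurent (eis_coef l) x j.+1
  = 2 * \sum_(d <- divisors l) (d%:R * x) ^+ j.*2.+1 / j.*2.+1`!%:R.
Proof.
case: l => // l _ x0; rewrite /laurent /eis_coef !eqn0Ngt !ltn0Sn mul2n doubleS.
rewrite -[LHS]mulrA [x ^+ _]exprSr mulfK // -mulr_suml.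
under [in RHS]eq_bigr do rewrite exprMn.
by rewrite -mulr_suml /=; ring.
Qed.

Lemma prod_part_eis n i j x y : (0 < i)%N -> (0 < j)%N -> x != 0 -> y != 0 ->
  prod_part n (eis_coef i) (eis_coef j) x y
  = 2 / (2 * n)`!%:R * \sum_(a <- divisors i) \sum_(b <- divisors j)
      ((a%:R * x + b%:R * y) ^+ (2 * n) - (a%:R * x - b%:R * y) ^+ (2 * n)).
Proof.
move=> i0 j0 x0 y0; rewrite /prod_part big_ord_recl big_ord_recr /=.
rewrite laurent_eis0 // mul0r add0r subnn [X in _ * X]laurent_eis0 // mulr0 addr0.
transitivity (2 * \sum_(a <- divisors i) \sum_(b <- divisors j)
   ((a%:R * x + b%:R * y) ^+ (2 * n) / (2 * n)`!%:R
    - (a%:R * x - b%:R * y) ^+ (2 * n) / (2 * n)`!%:R)); last first.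
  rewrite mulrAC -mulrA; congr (2 * _); rewrite mulr_suml; apply: eq_bigr => a _.
  by rewrite mulr_suml; apply: eq_bigr => d _; rewrite mulrBl.
transitivity (\sum_(k < n) 2 * \sum_(a <- divisors i) \sum_(b <- divisors j)
   2 * ((a%:R * x) ^+ k.*2.+1 / k.*2.+1`!%:R
       * ((b%:R * y) ^+ (n - k.+1).*2.+1 / (n - k.+1).*2.+1`!%:R))).
  apply: eq_bigr => k _; rewrite /bump /= add1n subSS -(subnSK (ltn_ord k)).
  rewrite !laurent_eisS // -mulrA; congr (2 * _).
  rewrite mulr_suml; apply: eq_bigr => a _.
  by rewrite mulrCA !mulr_sumr; apply: eq_bigr => d _.
rewrite -mulr_sumr; congr (2 * _); rewrite exchange_big /=; apply: eq_bigr => a _.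
rewrite exchange_big /=; apply: eq_bigr => d _.
by rewrite -mulr_sumr expr_odd_part.
Qed.

(** The degree [2n] part of [B(x) sinh w], where [B(x) = sum_j b_j x^(2j-1)] is
    the constant term of [S]. *)
Definition const_kernel n x w :=
  \sum_(j < n.+1) laurent b x j * (w ^+ (n - j).*2.+1 / (n - j).*2.+1`!%:R).

Lemma const_kernelN n x w : const_kernel n x (- w) = - const_kernel n x w.
Proof.
rewrite /const_kernel -sumrN; apply: eq_bigr => j _.
by rewrite exprNn -signr_odd /= odd_double; ring.
Qed.

Lemma prod_part_const n l x y : (0 < l)%N -> y != 0 ->
  prod_part n b (eis_coef l) x y
  = 2 * \sum_(d <- divisors l) const_kernel n x (d%:R * y).
Proof.
move=> l0 y0; rewrite /prod_part big_ord_recr /= subnn laurent_eis0 // mulr0 addr0.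
rewrite exchange_big /= mulr_sumr; apply: eq_bigr => j _.
rewrite subSn ?laurent_eisS // -1?ltnS //.
by rewrite mulrCA; congr (2 * _); rewrite mulr_sumr.
Qed.

(* This is [- 2 B(x) (exp x - 1) = exp x + 1], coefficient by coefficient. *)
Hypothesis b_rec : forall r, \sum_(j < r./2.+1) b j / (r.+1 - j.*2)`!%:R
  = - 2^-1 * (r`!%:R^-1 + (r == 0%N)%:R).

(** With [B(x) = - coth(x/2) / 2] this is the degree [2n] part of
    [coth(x/2) (sinh(w + x) - sinh w) = cosh(w + x) + cosh w]. *)
Lemma const_kernel_step n x w : x != 0 ->
  const_kernel n x (w + x) - const_kernel n x w
  = - (2 * (2 * n)`!%:R)^-1 * (w ^+ (2 * n) + (w + x) ^+ (2 * n)).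
Proof.
move=> x0; rewrite /const_kernel -sumrB mul2n.
pose T (p : nat) (j : nat) := w ^+ p / p`!%:R * x ^+ (n.*2 - p)
   * (b j / ((n.*2 - p).+1 - j.*2)`!%:R).
transitivity (\sum_(j < n.+1) \sum_(p < n.*2.+1 | (p < (n - j).*2.+1)%N) T p j).
  apply: eq_bigr => j _; rewrite -mulrBr exprD_fact big_ord_recr /= subnn.
  rewrite expr0 fact0 divr1 mulr1 addrK mulr_sumr.
  have jn : (j <= n)%N by rewrite -ltnS.
  rewrite (big_ord_widen n.*2.+1 (fun p => laurent b x j * (w ^+ p / p`!%:R *
    (x ^+ ((n - j).*2.+1 - p) / ((n - j).*2.+1 - p)`!%:R)))); last by lia.
  apply: eq_bigr => p pj; rewrite /T /laurent.
  have -> : ((n - j).*2.+1 - p = (n.*2 - p).+1 - j.*2)%N by lia.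
  have E : x ^+ (2 * j) * x ^+ ((n.*2 - p).+1 - j.*2) = x ^+ (n.*2 - p) * x.
    by rewrite -exprD -exprSr; congr (_ ^+ _); lia.
  by rewrite -[x ^+ (n.*2 - p)](mulfK x0) -E; ring.
rewrite (exchange_big_dep xpredT) //=.
transitivity (\sum_(p < n.*2.+1) w ^+ p / p`!%:R * x ^+ (n.*2 - p)
   * (- 2^-1 * ((n.*2 - p)`!%:R^-1 + (n.*2 - p == 0)%N%:R))).
  apply: eq_bigr => p _; have := ltn_ord p => pn.
  rewrite -b_rec (big_ord_widen n.+1 (fun j => b j / ((n.*2 - p).+1 - j.*2)`!%:R)); last by lia.
  by rewrite mulr_sumr; apply: eq_bigl => j; have := ltn_ord j; lia.
have -> : - (2 * n.*2`!%:R)^-1 * (w ^+ n.*2 + (w + x) ^+ n.*2)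
  = - 2^-1 * (w ^+ n.*2 / n.*2`!%:R + (w + x) ^+ n.*2 / n.*2`!%:R).
  by rewrite invfM; ring.
rewrite exprD_fact [in RHS]big_ord_recr big_ord_recr /= subnn expr0 fact0.
rewrite [in RHS]addrCA [RHS]mulrDr mulr_sumr; congr (_ + _); last first.
  by rewrite !invr1 /=; ring.
apply: eq_bigr => p _; have := ltn_ord p => pn.
have -> : (n.*2 - p == 0)%N = false by lia.
by rewrite addr0; ring.
Qed.

(** The single steps telescope along [w, w + x, ..., w + d x] and produce the
    trapezoidal sum of [cosh] over that progression. *)
Lemma const_kernel_steps n d x w : x != 0 -> (0 < d)%N ->
  const_kernel n x (w + d%:R * x) - const_kernel n x w
  = - (2 * (2 * n)`!%:R)^-1 * (w ^+ (2 * n) + (w + d%:R * x) ^+ (2 * n)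
      + 2 * \sum_(1 <= a < d) (w + a%:R * x) ^+ (2 * n)).
Proof.
move=> x0; case: d => // d _; elim: d => [|d IHd].
  by rewrite big_geq // mul1r const_kernel_step //; ring.
rewrite -[_ - _](subrKA (const_kernel n x (w + d.+1%:R * x))) IHd.
have -> : w + d.+2%:R * x = w + d.+1%:R * x + x by rewrite -[d.+2]addn1 natrD; ring.
by rewrite const_kernel_step // [in RHS]big_nat_recr //=; ring.
Qed.

Lemma sum_reverse (V : nmodType) (g : nat -> V) d :
  \sum_(1 <= a < d) g (d - a)%N = \sum_(1 <= a < d) g a.
Proof.
rewrite [RHS]big_nat_rev /= add1n; apply: eq_bigr => a _.
by rewrite subSS.
Qed.

(** The six kernels produced by the three-term operator pair up into differences
    along the progressions [d y + a x], [d x + a y] and [- d y + a (x + y)], whose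
    interior terms are exactly those left over by [quads_even_identity]. *)
Lemma lewis_const_part n l x y : (0 < l)%N -> x != 0 -> y != 0 -> x + y != 0 ->
  let H z := z ^+ (2 * n) in
  lewis (prod_part n b (eis_coef l)) x y + lewis (prod_part n (eis_coef l) b) x y
  = 2 / (2 * n)`!%:R * \sum_(d <- divisors l)
     ((H (d%:R * (x + y)) + H (d%:R * x) + H (d%:R * y))
      + \sum_(1 <= a < d) (H (a%:R * x + d%:R * y)
          + H (d%:R * x + (d - a)%:R * y) + H (a%:R * x - (d - a)%:R * y))).
Proof.
move=> l0 x0 y0 xy0 H; rewrite /lewis ![prod_part n (eis_coef l) b _ _]prod_part_sym.
rewrite !prod_part_const // -!mulrBr -mulrDr.
rewrite -!sumrB -big_split /= !mulr_sumr !big_seq; apply: eq_bigr => d.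
rewrite -dvdn_divisors // => dl; have d0 := dvdn_gt0 l0 dl.
have H_even z : H (- z) = H z by rewrite /H exprNn -signr_odd oddM mul1r.
pose c := - (2 * (2 * n)`!%:R)^-1 : F.
have Kx : const_kernel n x (d%:R * (x + y)) - const_kernel n x (d%:R * y)
   = c * (H (d%:R * y) + H (d%:R * (x + y))
          + 2 * \sum_(1 <= a < d) H (a%:R * x + d%:R * y)).
  rewrite [d%:R * (x + y)]mulrDr [d%:R * x + _]addrC const_kernel_steps //.
  by under [in RHS]eq_bigr do rewrite addrC.
have Ky : const_kernel n y (d%:R * (x + y)) - const_kernel n y (d%:R * x)
   = c * (H (d%:R * x) + H (d%:R * (x + y))
          + 2 * \sum_(1 <= a < d) H (d%:R * x + (d - a)%:R * y)).
  rewrite [d%:R * (x + y)]mulrDr const_kernel_steps //.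
  by rewrite (sum_reverse (fun a => H (d%:R * x + a%:R * y))).
have Kxy : const_kernel n (x + y) (d%:R * x) + const_kernel n (x + y) (d%:R * y)
   = c * (H (d%:R * y) + H (d%:R * x)
          + 2 * \sum_(1 <= a < d) H (a%:R * x - (d - a)%:R * y)).
  have := const_kernel_steps n (- (d%:R * y)) xy0 d0.
  rewrite const_kernelN opprK mulrDr [- _ + _]addrC addrK -/c => ->.
  rewrite -!/(H _) H_even; congr (c * (_ + 2 * _)).
  apply: eq_big_nat => a /andP[_ ad]; congr H; rewrite natrB 1?ltnW //; ring.
set S1 := \sum_(1 <= a < d) H (a%:R * x + _) in Kx.
set S2 := \sum_(1 <= a < d) _ in Ky.
set S3 := \sum_(1 <= a < d) _ in Kxy.
rewrite !big_split /= -/S1 -/S2 -/S3.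
transitivity (- 2 * ((const_kernel n x (d%:R * (x + y)) - const_kernel n x (d%:R * y))
  + (const_kernel n y (d%:R * (x + y)) - const_kernel n y (d%:R * x))
  + (const_kernel n (x + y) (d%:R * x) + const_kernel n (x + y) (d%:R * y)))).
  ring.
by rewrite Kx Ky Kxy /c; field; rewrite factr_neq0.
Qed.

Lemma lewis_sum (I : Type) (s : seq I) (P : pred I) (f : I -> F -> F -> F) x y :
  lewis (fun x y => \sum_(i <- s | P i) f i x y) x y = \sum_(i <- s | P i) lewis (f i) x y.
Proof. by rewrite /lewis !sumrB. Qed.

(** The interior terms of the constant part cancel against the solutions with
    [c = d]; the end points of the progressions raise the multiplicity
    [l/d - 1] of the solutions with [a = b] to [l/d]. *)
Lemma lewis_eis_part n l x y : (0 < l)%N -> x != 0 -> y != 0 -> x + y != 0 ->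
  \sum_(i < l.+1) lewis (prod_part n (eis_coef i) (eis_coef (l - i)%N)) x y
  = 2 / (2 * n)`!%:R * (\sum_(d <- divisors l) d%:R ^+ (2 * n) * (l %/ d)%:R)
    * (x ^+ (2 * n) + y ^+ (2 * n) + (x + y) ^+ (2 * n)).
Proof.
move=> l0 x0 y0 xy0.
pose H (z : F) := z ^+ (2 * n).
have H_even z : H (- z) = H z by rewrite /H exprNn -signr_odd oddM mul1r.
pose Q i := lewis (prod_part n (eis_coef i) (eis_coef (l - i)%N)) x y.
have -> : \sum_(i < l.+1) Q i = (Q 0%N + Q l) + \sum_(1 <= i < l) Q i.
  move: Q; case: l l0 => // l _ Q; rewrite big_ord_recl big_ord_recr big_add1 big_mkord.
  by rewrite addrA addrAC.
rewrite {1 2}/Q subn0 subnn lewis_const_part //.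
have -> : \sum_(1 <= i < l) Q i = 2 / (2 * n)`!%:R * \sum_(p <- quads l)
   (let a := p.1.1%:R in let b := p.1.2%:R in
     (H (a * x + b * y) - H (a * x - b * y))
     - (H (a * (x + y) + b * y) - H (a * (x + y) - b * y))
     - (H (a * x + b * (x + y)) - H (a * x - b * (x + y)))).
  rewrite -(quads_convolution (fun a b =>
     (H (a%:R * x + b%:R * y) - H (a%:R * x - b%:R * y))
     - (H (a%:R * (x + y) + b%:R * y) - H (a%:R * (x + y) - b%:R * y))
     - (H (a%:R * x + b%:R * (x + y)) - H (a%:R * x - b%:R * (x + y))))).
  rewrite mulr_sumr; apply: eq_big_nat => i /andP[i0 il].
  rewrite /Q /lewis !prod_part_eis ?subn_gt0 // -!mulrBr -!sumrB; congr (_ * _).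
  by apply: eq_bigr => a _; rewrite -!sumrB.
rewrite quads_even_identity // -mulrDr -big_split -mulrA; congr (_ * _).
rewrite mulr_suml /= !big_seq; apply: eq_bigr => d; rewrite -dvdn_divisors // => dl.
have ld0 : (0 < l %/ d)%N by rewrite divn_gt0 ?(dvdn_gt0 l0 dl) // dvdn_leq.
rewrite addrACA addrN addr0 -mulrS prednK // -mulr_natr /H !exprMn; ring.
Qed.
End Coefficients.
End Period.

(** * The constant term: addition formula of the hyperbolic cotangent *)

Section LowOrder.
Variable R : idomainType.
Implicit Types p q : {poly R}.

(** Congruence to zero modulo ['X^m]: power series are represented by truncated
    polynomials, and identities between them hold only up to that order. *)
Definition vanish m p := forall i, (i < m)%N -> p`_i = 0.

Lemma vanishD m p q : vanish m p -> vanish m q -> vanish m (p + q).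
Proof. by move=> Hp Hq i im; rewrite coefD Hp // Hq // addr0. Qed.

Lemma vanishM m p q : vanish m q -> vanish m (p * q).
Proof.
move=> Hq i im; rewrite coefM big1 // => j _.
by rewrite Hq ?mulr0 // (leq_ltn_trans (leq_subr _ _)).
Qed.

(** A factor with a simple zero at the origin can be cancelled at the price of
    one order of precision. *)
Lemma vanish_cancel m p q : p`_0 = 0 -> p`_1 != 0 ->
  vanish m.+1 (p * q) -> vanish m q.
Proof.
move=> p0 p1 Hpq i; elim/ltn_ind: i => i IHi im.
have := Hpq i.+1 im; rewrite coefM big_ord_recl p0 mul0r add0r big_ord_recl /=.
rewrite /bump /= addn0 subSS subn0 big1 ?addr0 => [/eqP|j _].
  by rewrite mulf_eq0 (negPf p1) => /eqP.
by rewrite IHi ?mulr0 //; have := ltn_ord j; rewrite /bump /=; lia.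
Qed.

Lemma sum_even_terms (G : nat -> R) n :
  \sum_(k < n.*2.+1) (if odd k then 0 else G k./2) = \sum_(j < n.+1) G j.
Proof.
elim: n => [|n IHn]; first by rewrite !big_ord_recl !big_ord0.
rewrite doubleS 2!big_ord_recr /= IHn [in RHS]big_ord_recr /=.
by rewrite odd_double addr0 doubleK.
Qed.

End LowOrder.

Section Exponential.
Variable F : numFieldType.
Variable M : nat.
Implicit Types (x y : F) (b : nat -> F).

(** [exp(x t) - 1] modulo [t^M]. *)
Definition expm1 x : {poly F} := \poly_(i < M) (x ^+ i / i`!%:R) - 1.

(** [t B(x t)] modulo [t^M], where [B(x) = sum_j b_j x^(2j-1)]; the factor [t]
    removes the pole. *)
Definition even_series b x : {poly F} :=
  \poly_(i < M) (if odd i then 0 else laurent b x i./2).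

Lemma expm1_coef0 x : (0 < M)%N -> (expm1 x)`_0 = 0.
Proof. by move=> M0; rewrite coefB coef_poly M0 coef1 expr0 fact0 divr1 subrr. Qed.

Lemma expm1_coefS x i : (i.+1 < M)%N -> (expm1 x)`_i.+1 = x ^+ i.+1 / i.+1`!%:R.
Proof. by move=> iM; rewrite coefB coef_poly iM coef1 subr0. Qed.

Lemma expm1D (x y : F) : vanish M
  (expm1 (x + y) - (expm1 x * expm1 y + expm1 x + expm1 y)).
Proof.
move=> i iM; rewrite /expm1.
set P := \poly_(i < M) _; set Px := \poly_(i < M) _; set Py := \poly_(i < M) _.
have -> : P - 1 - ((Px - 1) * (Py - 1) + (Px - 1) + (Py - 1)) = P - Px * Py by ring.
rewrite coefB coefM coef_poly iM exprD_fact; apply/eqP; rewrite subr_eq0; apply/eqP.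
apply: eq_bigr => j _; rewrite !coef_poly.
by rewrite (leq_ltn_trans _ iM) ?(leq_ltn_trans _ iM) ?leq_subr // -ltnS.
Qed.

Lemma even_series_expm1 b x r : x != 0 -> (r.+1 < M)%N ->
  (even_series b x * expm1 x)`_r.+1
  = x ^+ r * \sum_(j < r./2.+1) b j / (r.+1 - j.*2)`!%:R.
Proof.
move=> x0 rM; rewrite coefM big_ord_recr /= subnn expm1_coef0 ?mulr0 ?addr0; last by lia.
pose G j := laurent b x j * (x ^+ (r.+1 - j.*2) / (r.+1 - j.*2)`!%:R).
transitivity (\sum_(k < r.+1) (if odd k then 0 else G k./2)).
  apply: eq_bigr => k _; have := ltn_ord k => kr.
  rewrite coef_poly; have -> : (k < M)%N by lia.
  case: ifP => [_|/negbT ok]; first by rewrite mul0r.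
  by rewrite /G even_halfK // subSn -1?ltnS // expm1_coefS //; lia.
transitivity (\sum_(k < r./2.*2.+1) (if odd k then 0 else G k./2)).
  rewrite -[in LHS](odd_double_half r); case: (odd r) => //=.
  by rewrite add1n big_ord_recr /= odd_double /= addr0.
rewrite sum_even_terms mulr_sumr; apply: eq_bigr => j _; have := ltn_ord j => jr.
rewrite /G /laurent.
have -> : x ^+ r = x ^+ (2 * j) / x * x ^+ (r.+1 - j.*2).
  by rewrite mulrAC -exprD -[LHS](mulfK x0) -exprSr; congr (x ^+ _ / x); lia.
by ring.
Qed.
End Exponential.

Section Bernoulli.
Variable F : numFieldType.
Variable b : nat -> F.

Section Addition.
Hypothesis b_rec : forall r, \sum_(j < r./2.+1) b j / (r.+1 - j.*2)`!%:R
  = - 2^-1 * (r`!%:R^-1 + (r == 0%N)%:R).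

Lemma even_series_coth M (x : F) : x != 0 ->
  vanish M (2 * even_series M b x * expm1 M x + 'X * (expm1 M x + 2)).
Proof.
move=> x0 [|r] rM; rewrite -mulrA coefD mulr_natl coefMn coefXM /=.
  by rewrite ?coefM big_ord_recl big_ord0 subnn expm1_coef0 // mulr0 !addr0 mul0rn.
rewrite even_series_expm1 // b_rec coefD.
have -> : (expm1 M x)`_r = x ^+ r / r`!%:R - (r == 0%N)%:R.
  case: r rM => [|r] rM; first by rewrite expm1_coef0 ?expr0 ?fact0 ?divr1 ?subrr //; lia.
  by rewrite expm1_coefS ?subr0 //; lia.
rewrite -polyC_natr coefC.
by case: r rM => [|r] _; rewrite ?expr0 ?fact0 /=; field; rewrite ?factr_neq0.
Qed.

(** With [ez = ex ey + ex + ey] and [2 c e = - t (e + 2)] in each of the three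
    variables, the left-hand side vanishes: this is the addition formula of
    [coth] cleared of denominators.  The right-hand side writes it explicitly in
    the ideal generated by these relations, so that it can be used modulo a
    power of [t]. *)
Lemma coth_addition_certificate (R : comNzRingType) (t cx cy cz ex ey ez : R) :
  ez * (ey * (ex * (4 * (cx * cy - cz * cy - cx * cz) + t ^+ 2)))
  = (2 * cy * ey * ez - 2 * cz * ez * ey) * (2 * cx * ex + t * (ex + 2))
    + ((- (t * (ex + 2)) * ez - 2 * cz * ez * ex) * (2 * cy * ey + t * (ey + 2))
    + ((t * (ex + 2) * ey + t * (ey + 2) * ex) * (2 * cz * ez + t * (ez + 2))
    + 4 * t ^+ 2 * (ez - (ex * ey + ex + ey)))).
Proof. ring. Qed.

(** The addition formula makes [B(x) B(y) - B(x+y) (B(x) + B(y))] the constant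
    [-1/4], so its part of degree [2n > 0] is zero. *)
Lemma even_series_lewis n (x y : F) : (0 < n)%N -> x != 0 -> y != 0 -> x + y != 0 ->
  lewis (prod_part n b b) x y = 0.
Proof.
(* Precision [2n + 3] is needed to read the coefficient of [t^(2n+2)], and three
   factors [expm1] are cancelled. *)
move=> n0 x0 y0 xy0; pose M := (n.*2 + 6)%N.
have Qv : vanish n.*2.+3 (4 * (even_series M b x * even_series M b y
   - even_series M b (x + y) * even_series M b y
   - even_series M b x * even_series M b (x + y)) + 'X ^+ 2).
  have M0 : (0 < M)%N by rewrite /M; lia.
  have E1 (w : F) : w != 0 -> (expm1 M w)`_1 != 0.
    by move=> w0; rewrite expm1_coefS ?fact1 ?divr1 ?expr1 // /M; lia.
  refine (vanish_cancel (expm1_coef0 x M0) (E1 x x0) _).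
  refine (vanish_cancel (expm1_coef0 y M0) (E1 y y0) _).
  refine (vanish_cancel (expm1_coef0 (x + y) M0) (E1 _ xy0) _).
  rewrite coth_addition_certificate -[n.*2.+3.+3]addn3 -[n.*2.+3]addn3 -addnA -/M.
  refine (vanishD (vanishM _ (even_series_coth _)) _) => //.
  refine (vanishD (vanishM _ (even_series_coth _)) _) => //.
  refine (vanishD (vanishM _ (even_series_coth _)) _) => //.
  exact/vanishM/expm1D.
have coefCC w w' : (even_series M b w * even_series M b w')`_n.+1.*2
    = prod_part n b b w w'.
  rewrite coefM /prod_part.
  rewrite -(sum_even_terms (fun j => laurent b w j * laurent b w' (n.+1 - j))).
  apply: eq_bigr => k _; have := ltn_ord k => kn.
  rewrite !coef_poly; have -> : (k < M)%N by rewrite /M; lia.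
  have -> : (n.+1.*2 - k < M)%N by rewrite /M; lia.
  case: ifP => [_|ok]; first by rewrite mul0r.
  rewrite oddB ?odd_double ?ok //; congr (_ * laurent b w' _); lia.
have := Qv n.+1.*2; rewrite coefD mulr_natl coefMn coefXn !coefB !coefCC.
have -> : (n.+1.*2 == 2)%N = false by lia.
have lt : (n.+1.*2 < n.*2.+3)%N by lia.
rewrite addr0 => /(_ lt)/eqP; rewrite mulrn_eq0 => /eqP E.
by rewrite /lewis E.
Qed.
End Addition.
End Bernoulli.

(** * From the quadratic recurrence to the Bernoulli recurrence *)

Section QuadraticRecurrence.
Variable F : numFieldType.
Variable b : nat -> F.
Hypothesis b0 : b 0 = -1.
(* This is [B' = B^2 - 1/4], the equation satisfied by [- coth(x/2) / 2]. *)
Hypothesis b_quad : forall j,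
  (2 * j)%:R * b j = b j + \sum_(i < j.+1) b i * b (j - i)%N - (j == 1%N)%:R / 4.

Lemma coefX_deriv (R : nzRingType) (p : {poly R}) i : ('X * p^`())`_i = p`_i *+ i.
Proof. by rewrite coefXM coef_deriv; case: i. Qed.

Lemma even_series1_coef M i : (i < M)%N ->
  (even_series M b 1)`_i = if odd i then 0 else b i./2.
Proof. by move=> iM; rewrite coef_poly iM /laurent expr1n mulr1 divr1. Qed.

Lemma even_series_riccati M : let c := even_series M b 1 in
  vanish M (4 * ('X * c^`()) - (4 * (c + c * c) - 'X ^+ 2)).
Proof.
move=> c i iM; rewrite coefB mulr_natl coefMn coefX_deriv coefB mulr_natl coefMn coefD.
rewrite coefXn even_series1_coef //.
have -> : (c * c)`_i = if odd i then 0 else \sum_(k < i./2.+1) b k * b (i./2 - k)%N.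
  rewrite coefM.
  transitivity (\sum_(k < i.+1) if odd k then 0 else if odd i then 0 else
     b k./2 * b (i./2 - k./2)%N).
    apply: eq_bigr => k _; have := ltn_ord k => ki.
    rewrite !even_series1_coef; try lia.
    case: ifP => [_|ok]; first by rewrite mul0r.
    rewrite oddB // ok addbF; case: ifP => [_|oi]; first by rewrite mulr0.
    by congr (_ * b _); lia.
  case: ifP => [oi|oi]; first by rewrite big1 // => k _; case: ifP.
  by rewrite -[in LHS](even_halfK (negbT oi))
     (sum_even_terms (fun k => b k * b (i./2.*2./2 - k)%N)) doubleK.
case: ifP => [oi|oi].
  have -> : (i == 2)%N = false by lia.
  by rewrite mul0rn addr0 mul0rn subr0 subrr.
have := b_quad i./2; rewrite mul2n even_halfK ?oi //.
have -> : (i./2 == 1)%N = (i == 2)%N by lia.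
by rewrite mulr_natl => ->; rewrite mulrnBl -[_ / 4 *+ 4]mulr_natr divfK ?pnatr_eq0 // subrr.
Qed.

Lemma expm1_deriv M : vanish M ('X * (expm1 M 1)^`() - 'X * (expm1 M (1 : F) + 1)).
Proof.
case=> [|i] iM; rewrite coefB coefX_deriv coefXM /= ?mulr0n ?subrr //.
rewrite expm1_coefS // (coefD (expm1 M 1)) coef1.
have -> : (expm1 M (1 : F))`_i + (i == 0%N)%:R = i`!%:R^-1.
  case: i iM => [|i] iM; first by rewrite expm1_coef0 ?add0r ?fact0 ?invr1 //; lia.
  by rewrite expm1_coefS ?expr1n ?addr0 ?div1r //; lia.
by rewrite expr1n mul1r factS natrM invfM -(mulr_natl (_ / _)) mulVKf ?pnatr_eq0 // subrr.
Qed.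

(** Put [c = t B(t)], [e = exp t - 1] and [U = 2 c e + t (e + 2)].  The Riccati
    equation for [B] gives the linear equation [2 t U' = (2 + 2 c + t) U].  As
    [2 + 2 c + t] has no constant term, the coefficient of [t^r] expresses [2 r U_r]
    through the earlier coefficients; since [U_0 = 0], all of [U] vanishes. *)
Lemma bernoulli_recurrence r : \sum_(j < r./2.+1) b j / (r.+1 - j.*2)`!%:R
  = - 2^-1 * (r`!%:R^-1 + (r == 0%N)%:R).
Proof.
pose M := r.+3.
have [c cE] : {c | c = even_series M b 1} by exists (even_series M b 1).
have [e eE] : {e | e = expm1 M (1 : F)} by exists (expm1 M 1).
pose U := 2 * c * e + 'X * (e + 2).
have ode : vanish M (2 * ('X * U^`()) - (2 + 2 * c + 'X) * U).
  have -> : 2 * ('X * U^`()) - (2 + 2 * c + 'X) * U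
    = e * (4 * ('X * c^`()) - (4 * (c + c * c) - 'X ^+ 2))
      + (4 * c + 2 * 'X) * ('X * e^`() - 'X * (e + 1)).
    have d2 : (2 : {poly F})^`() = 0 by rewrite -polyC_natr derivC.
    by rewrite /U derivD !derivM derivD d2 derivX; ring.
  apply: vanishD; apply/vanishM; rewrite ?cE ?eE.
    exact: even_series_riccati.
  exact: expm1_deriv.
have a0 : (2 + 2 * c + 'X)`_0 = 0.
  rewrite !coefD coefX mulr_natl coefMn cE even_series1_coef // b0.
  by rewrite !coef1 /=; ring.
have U0 : forall i, (i < M)%N -> U`_i = 0.
  elim/ltn_ind => -[_ _|i IHi iM].
    rewrite /U -mulrA coefD mulr_natl coefMn coefXM coefM big_ord_recl big_ord0.
    by rewrite subnn eE expm1_coef0 // mulr0 !addr0 mul0rn.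
  have := ode i.+1 iM; rewrite coefB mulr_natl coefMn coefX_deriv coefM.
  rewrite big_ord_recl a0 mul0r add0r big1 ?subr0 => [/eqP|k _].
    by rewrite !mulrn_eq0 /= => /eqP.
  by rewrite IHi ?mulr0 // /= /bump; have := ltn_ord k; lia.
have := U0 r.+1 _; rewrite /U -mulrA coefD mulr_natl coefMn coefXM /=.
rewrite cE eE even_series_expm1 ?oner_eq0 // expr1n mul1r coefD.
have -> : (expm1 M (1 : F))`_r = r`!%:R^-1 - (r == 0%N)%:R.
  case: (r) @M {c cE e eE U ode a0 U0} => [|r'] M.
    by rewrite expm1_coef0 // fact0 invr1 subrr.
  by rewrite expm1_coefS ?expr1n ?subr0 ?div1r // /M; lia.
rewrite -polyC_natr coefC => /(_ (ltnW (ltnSn _)))/eqP; set S := \sum_(j < _) _.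
rewrite addr_eq0 => /eqP E; rewrite -[LHS](mulfK (_ : 2 != 0)) ?pnatr_eq0 // mulr_natr E.
by case: (r == 0%N); rewrite /=; field; rewrite factr_neq0.
Qed.
End QuadraticRecurrence.

(** * The relations between binomial sums *)

Section BinomialRelations.
Variable F : numFieldType.

Lemma poly_eq0_of_nat_roots (p : {poly F}) :
  (forall m : nat, p.[m.+1%:R] = 0) -> p = 0.
Proof.
move=> Hp; apply/eqP; apply: contraT => p0.
pose rs := [seq m.+1%:R : F | m <- iota 0 (size p)].
have : (size rs < size p)%N.
  apply: max_poly_roots => //.
    by apply/allP => _ /mapP[m _ ->]; apply/rootP.
  by rewrite map_inj_uniq ?iota_uniq // => i j /eqP; rewrite eqr_nat eqSS => /eqP.
by rewrite size_map size_iota ltnn.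
Qed.

Lemma coef_X1_exp m i : ((('X : {poly F}) + 1) ^+ m)`_i = 'C(m, i)%:R.
Proof.
rewrite addrC exprDn.
under eq_bigr do rewrite expr1n mul1r -mulr_natl -polyC_natr mul_polyC.
rewrite -(poly_def m.+1 (fun i => 'C(m, i)%:R)) coef_poly ltnS.
by case: leqP => // im; rewrite bin_small.
Qed.

(** [sum_j c_j x^(2j-1) y^(2n+1-2j)]. *)
Definition homog n (c : nat -> F) x y :=
  \sum_(j < n.+2) c j * (x ^+ (2 * j) / x * (y ^+ (2 * (n.+1 - j)) / y)).

(** With [p(x) = sum_i c_i x^(2i)] the three-term equation at [(x, 1)], multiplied
    by [x (x + 1)], reads
    [x p(x + 1) + (x + 1)^(2n+2) p(x / (x + 1)) = (x + 1) p(x)].  This is an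
    identity of polynomials because it holds at all positive integers, and its
    coefficient of [x^k] is the claim: on the right, only one of [c_(k/2)] and
    [c_((k-1)/2)] is present, according to the parity of [k]. *)
Lemma lewis_coef n (c : nat -> F) :
  (forall x y, x != 0 -> y != 0 -> x + y != 0 -> lewis (homog n c) x y = 0) ->
  forall k, (0 < k <= 2 * n + 2)%N ->
  \sum_(i < n.+2) (if (k.-1 <= 2 * i)%N then 'C(2 * i, k.-1)%:R * c i else 0)
  + \sum_(i < n.+2) (if (2 * i <= k)%N
      then 'C(2 * n + 2 - 2 * i, 2 * n + 2 - k)%:R * c i else 0)
  = c k./2.
Proof.
move=> Hc [//|k] /= kn.
pose p i : {poly F} := 'X * ('X + 1) ^+ (2 * i)
  + 'X^(2 * i) * ('X + 1) ^+ (2 * n + 2 - 2 * i) - ('X + 1) * 'X^(2 * i).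
pose P := \sum_(i < n.+2) c i *: p i.
have P0 : P = 0.
  apply: poly_eq0_of_nat_roots => m; set x : F := m.+1%:R.
  have x0 : x != 0 by rewrite pnatr_eq0.
  have x1 : x + 1 != 0 by rewrite /x natr1 pnatr_eq0.
  have := Hc x 1 x0 (oner_neq0 _) x1.
  move/(congr1 (fun z => - (x * (x + 1)) * z)); rewrite mulr0 => E.
  rewrite -[RHS]E /P horner_sum /lewis /homog -!sumrB mulr_sumr.
  apply: eq_bigr => i _; rewrite !expr1n.
  have -> : (2 * (n.+1 - i) = 2 * n + 2 - 2 * i)%N by lia.
  rewrite /p !hornerE /=.
  by clearbody x; field; rewrite x0 x1.
have : P`_k.+1 = 0 by rewrite P0 coef0.
have -> : c k.+1./2 = \sum_(i < n.+2) (i == k.+1./2 :> nat)%:R * c i.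
  have kn2 : (k.+1./2 < n.+2)%N by lia.
  rewrite (bigD1 (Ordinal kn2)) //= eqxx mul1r big1 ?addr0 // => i.
  by rewrite -val_eqE /= => /negPf ->; rewrite mul0r.
rewrite /P coef_sum => E; apply/eqP; rewrite -subr_eq0 -[X in _ == X]E.
rewrite -big_split /= -sumrB; apply/eqP; apply: eq_bigr => i _; have := ltn_ord i => ni.
rewrite coefZ /p coefB coefD coefXM coefXnM !coef_X1_exp /=.
rewrite mulrDl mul1r coefD coefXM !coefXn /=.
have -> : (i == k.+1./2 :> nat)%:R = (k == 2 * i)%N%:R + (k.+1 == 2 * i)%N%:R :> F.
  rewrite -natrD; congr _%:R.
  by case: (eqVneq k) => ?; case: (eqVneq k.+1) => ?; case: (eqVneq (i : nat)) => ? //; lia.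
have -> : (if (k <= 2 * i)%N then 'C(2 * i, k)%:R * c i else 0)
    = 'C(2 * i, k)%:R * c i :> F.
  by case: leqP => // ik; rewrite bin_small // mul0r.
case: (ltnP k.+1 (2 * i)) => ik; first by ring.
have -> : 'C(2 * n + 2 - 2 * i, 2 * n + 2 - k.+1)
    = 'C(2 * n + 2 - 2 * i, k.+1 - 2 * i).
  rewrite -bin_sub; last by lia.
  by congr 'C(_, _); lia.
by ring.
Qed.
End BinomialRelations.

Section Relations.
Variable F : numFieldType.
Variable b : nat -> F.
Hypothesis b0 : b 0 = -1.
Hypothesis b_quad : forall j,
  (2 * j)%:R * b j = b j + \sum_(i < j.+1) b i * b (j - i)%N - (j == 1%N)%:R / 4.

Definition period_coef n l j : F :=
  - (\sum_(i < l.+1) eis_coef b i j * eis_coef b (l - i)%N (n.+1 - j)%N)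
  - ((j == 1%N)%:R + (j == n)%:R)
    * (2 / (2 * n)`!%:R * (l%:R * \sum_(d <- divisors l) d%:R ^+ (2 * n).-1)).

Lemma sum_delta (G : nat -> F) m k : (k < m)%N ->
  \sum_(j < m) (j == k :> nat)%:R * G j = G k.
Proof.
move=> km; rewrite (bigD1 (Ordinal km)) //= eqxx mul1r big1 ?addr0 // => i.
by rewrite -val_eqE /= => /negPf ->; rewrite mul0r.
Qed.

(** The derivative terms contribute
    [f_D(x,y) = x y^(2n-1) + x^(2n-1) y], for which
    [f_D(x+y,y) + f_D(x,x+y) - f_D(x,y) = x^2n + y^2n + (x+y)^2n]; this cancels the
    right-hand side of [lewis_eis_part]. *)
Lemma lewis_period_coef n l x y : (0 < n)%N -> x != 0 -> y != 0 -> x + y != 0 ->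
  lewis (homog n (period_coef n l)) x y = 0.
Proof.
move=> n0 x0 y0 xy0.
pose D : F := 2 / (2 * n)`!%:R * (l%:R * \sum_(d <- divisors l) d%:R ^+ (2 * n).-1).
pose f x y := \sum_(i < l.+1) prod_part n (eis_coef b i) (eis_coef b (l - i)%N) x y.
have homogE x' y' : x' != 0 -> y' != 0 -> homog n (period_coef n l) x' y'
   = - f x' y' - D * (x' * y' ^+ (2 * n).-1 + x' ^+ (2 * n).-1 * y').
  move=> x'0 y'0; rewrite /homog /period_coef -/D.
  pose m j := x' ^+ (2 * j) / x' * (y' ^+ (2 * (n.+1 - j)) / y').
  have m1 : m 1%N = x' * y' ^+ (2 * n).-1.
    rewrite /m muln1 expr2 mulfK // subSS subn0; congr (_ * _).
    by rewrite -[in LHS](prednK (_ : 0 < 2 * n)%N) ?muln_gt0 // exprSr mulfK.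
  have mn : m n = x' ^+ (2 * n).-1 * y'.
    rewrite /m subSnn muln1 [y' ^+ 2]expr2 mulfK //; congr (_ * _).
    by rewrite -[in LHS](prednK (_ : 0 < 2 * n)%N) ?muln_gt0 // exprSr mulfK.
  rewrite -m1 -mn -(@sum_delta m n.+2 1) // -(@sum_delta m n.+2 n) //.
  rewrite -big_split mulr_sumr /f /prod_part exchange_big -sumrN -sumrB /=.
  apply: eq_bigr => j _.
  rewrite -/(m j) mulrBl mulNr mulr_suml; congr (- _ - _); last by ring.
  by apply: eq_bigr => i _; rewrite /laurent /m; ring.
have lewis_f : lewis f x y = D * (x ^+ (2 * n) + y ^+ (2 * n) + (x + y) ^+ (2 * n)).
  rewrite /f lewis_sum; case: (posnP l) => [l0|l0]; last first.
    rewrite lewis_eis_part //; last exact: bernoulli_recurrence.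
    congr (_ * _); rewrite /D; congr (_ * _); rewrite mulr_sumr !big_seq.
    apply: eq_bigr => d; rewrite -dvdn_divisors // => dl.
    rewrite -[(2 * n)%N in LHS]prednK ?muln_gt0 // exprSr -mulrA -natrM.
    by rewrite [(d * _)%N]mulnC divnK // mulrC.
  rewrite /D l0 big_ord_recl big_ord0 /= subn0 mul0r mulr0 mul0r addr0.
  apply: even_series_lewis => //; exact: bernoulli_recurrence.
move: lewis_f; rewrite /lewis !homogE // => E.
transitivity (- (f x y - f (x + y) y - f x (x + y))
  + D * (x * x ^+ (2 * n).-1 + y * y ^+ (2 * n).-1 + (x + y) * (x + y) ^+ (2 * n).-1)).
  by ring.
by rewrite E -!exprS prednK ?muln_gt0 // addNr.
Qed.

Theorem period_coef_relation n l k : (0 < n)%N -> (0 < k <= 2 * n + 2)%N ->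
  \sum_(i < n.+2) (if (k.-1 <= 2 * i)%N
      then 'C(2 * i, k.-1)%:R * period_coef n l i else 0)
  + \sum_(i < n.+2) (if (2 * i <= k)%N
      then 'C(2 * n + 2 - 2 * i, 2 * n + 2 - k)%:R * period_coef n l i else 0)
  = period_coef n l k./2.
Proof.
by move=> n0; apply: lewis_coef => x y x0 y0 xy0; exact: lewis_period_coef.
Qed.
End Relations.

(** * Truncated convolution of even zeta values *)

Import Order.TTheory.

Section Zeta.
Variable F : realFieldType.

Definition zeta_partial (s K : nat) : F := \sum_(1 <= k < K.+1) k%:R^-1 ^+ s.
Let harmonic := zeta_partial 1.

Lemma harmonicS K : harmonic K.+1 = harmonic K + K.+1%:R^-1.
Proof. by rewrite /harmonic /zeta_partial big_nat_recr //= expr1. Qed.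

(** Both fractions telescope into harmonic numbers; the omitted term [m = k] and
    the asymmetry of the range account for [3 / (2 k)]. *)
Lemma sum_inv_sub_add k d : (0 < k)%N ->
  \sum_(1 <= m < (k + d).+1 | m != k) ((m%:R - k%:R)^-1 - (m%:R + k%:R)^-1)
  = 3 / (2 * k%:R) + harmonic d - harmonic (k + d + k).
Proof.
move=> k0; have k0' : k%:R != 0 :> F by rewrite pnatr_eq0 -lt0n.
elim: d => [|d IHd].
  rewrite addn0 big_mkcond big_nat_recr //= eqxx addr0.
  transitivity (\sum_(1 <= m < k) ((m%:R - k%:R)^-1 - (m%:R + k%:R)^-1) : F).
    by apply: eq_big_nat => m /andP[_ mk]; rewrite neq_ltn mk.
  rewrite sumrB.
  have -> : \sum_(1 <= m < k) (m%:R - k%:R)^-1 = k%:R^-1 - harmonic k :> F.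
    rewrite -(prednK k0) harmonicS prednK // opprD addrCA subrr addr0.
    rewrite /harmonic /zeta_partial prednK // -sumrN.
    rewrite -(sum_reverse (fun a => - (a%:R^-1 ^+ 1))).
    apply: eq_big_nat => m /andP[_ mk].
    by rewrite expr1 natrB ?(ltnW mk) // -invrN opprB.
  have -> : harmonic (k + k) = harmonic k + \sum_(1 <= m < k) (m%:R + k%:R)^-1 + (2 * k%:R)^-1.
    have E : (k + k = (k + k.-1).+1)%N by lia.
    rewrite E harmonicS -E; congr (_ + _); last by rewrite natrD; congr _^-1; ring.
    rewrite /harmonic /zeta_partial (@big_cat_nat _ _ _ (k.+1)) //=; try lia.
    congr (_ + _); rewrite -addSn -[k.+1]add1n big_addn.
    have -> : (1 + k + k.-1 - k = k)%N by lia.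
    by apply: eq_big_nat => m _; rewrite expr1 natrD.
  have -> : harmonic 0 = 0 by rewrite /harmonic /zeta_partial big_geq.
  by field.
rewrite addnS big_mkcond big_nat_recr //= -big_mkcond /= IHd.
have -> : (k + d).+1 != k by lia.
have -> : ((k + d).+1 + k = (k + d + k).+1)%N by lia.
rewrite !harmonicS.
have -> : (k + d).+1%:R - k%:R = d.+1%:R :> F by rewrite -natrB; [congr _%:R|]; lia.
have -> : (k + d).+1%:R + k%:R = (k + d + k).+1%:R :> F by rewrite -natrD; congr _%:R; lia.
by ring.
Qed.

Lemma harmonic_gap_bound k d : (0 < k)%N ->
  0 <= harmonic (k + d + k) - harmonic d <= (2 * k)%:R / d.+1%:R.
Proof.
move=> k0.
have -> : harmonic (k + d + k) - harmonic d = \sum_(d.+1 <= i < (k + d + k).+1) i%:R^-1.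
  rewrite /harmonic /zeta_partial (@big_cat_nat _ _ _ (d.+1)) //=; try lia.
  by rewrite addrAC subrr add0r; apply: eq_bigr => i _; rewrite expr1.
apply/andP; split; first by apply: sumr_ge0 => i _; rewrite invr_ge0.
have -> : (2 * k)%:R / d.+1%:R = \sum_(d.+1 <= i < (k + d + k).+1) d.+1%:R^-1 :> F.
  rewrite sumr_const_nat mulr_natl; congr (_ *+ _); lia.
rewrite [leLHS]big_nat_cond [leRHS]big_nat_cond; apply: ler_sum => i /andP[/andP[di _] _].
by rewrite lef_pV2 ?ler_nat ?posrE ?ltr0n // (leq_trans _ di).
Qed.

(** Truncated form of [sum_(m <> k) 1 / (m^2 - k^2) = 3 / (4 k^2)]. *)
Lemma sum_inv_sqr_diff k K : (0 < k <= K)%N ->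
  `|\sum_(1 <= m < K.+1 | m != k) (m%:R ^+ 2 - k%:R ^+ 2)^-1
     - 3 / 4 * k%:R^-1 ^+ 2| <= (K.+1 - k)%:R^-1 :> F.
Proof.
move=> /andP[k0 kK]; have k0' : 0 < k%:R :> F by rewrite ltr0n.
have kn0 : k%:R != 0 :> F by rewrite gt_eqF.
have [d dE] : {d | (K = k + d)%N} by exists (K - k)%N; rewrite subnKC.
subst K; rewrite subSn // addKn.
have -> : \sum_(1 <= m < (k + d).+1 | m != k) (m%:R ^+ 2 - k%:R ^+ 2)^-1
  = (2 * k%:R)^-1 * \sum_(1 <= m < (k + d).+1 | m != k)
      ((m%:R - k%:R)^-1 - (m%:R + k%:R)^-1) :> F.
  rewrite mulr_sumr; apply: eq_bigr => m mk.
  have m1 : m%:R - k%:R != 0 :> F by rewrite subr_eq0 eqr_nat.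
  have m2 : m%:R + k%:R != 0 :> F by rewrite -natrD pnatr_eq0; lia.
  have -> : m%:R ^+ 2 - k%:R ^+ 2 = (m%:R - k%:R) * (m%:R + k%:R) :> F by ring.
  by field; rewrite m1 m2 kn0.
rewrite sum_inv_sub_add //.
set g := harmonic (k + d + k); set h := harmonic d.
have /andP[] := harmonic_gap_bound d k0; rewrite -/g -/h => g0 g1.
have -> : (2 * k%:R)^-1 * (3 / (2 * k%:R) + h - g) - 3 / 4 * k%:R^-1 ^+ 2
   = - ((g - h) / (2 * k%:R)) by field.
rewrite normrN ger0_norm ?divr_ge0 ?mulr_ge0 ?ler0n //.
by rewrite ler_pdivrMr ?mulr_gt0 // mulrC -natrM.
Qed.

Lemma geometric_difference n (u v : F) : u != 0 -> v != 0 -> u != v ->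
  \sum_(1 <= j < n.+2) u ^+ j * v ^+ (n.+2 - j)
  = (u ^+ n.+1 - v ^+ n.+1) * (v^-1 - u^-1)^-1.
Proof.
move=> u0 v0 uv; rewrite subrXX big_add1 big_mkord /=.
have uv0 : u - v != 0 by rewrite subr_eq0.
have -> : v^-1 - u^-1 = (u - v) / (u * v) by field; rewrite u0 v0.
rewrite invf_div mulrAC mulrCA divff // mulr1 (reindex_inj rev_ord_inj) mulr_sumr.
apply: eq_bigr => j _; have := ltn_ord j => jn /=.
have -> : ((n.+1 - j.+1).+1 = (n.+1 - 1 - j).+1)%N by lia.
have -> : (n.+2 - (n.+1 - 1 - j).+1 = j.+1)%N by lia.
rewrite !subSS subn0 !exprS; ring.
Qed.

(** Euler's argument on the square [1 <= k, m <= K].  The diagonal of the double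
    sum gives [n + 1] copies of [zeta(2n+4)].  Off the diagonal the sum over [j] is
    geometric, equal to an antisymmetric kernel [1 / (m^2 - k^2)] times a
    difference, so the double sum reduces to [sum_(m <> k) 1 / (m^2 - k^2)], which
    supplies the missing [3/2]. *)
Lemma zeta_partial_convolution n K :
  `|\sum_(1 <= j < n.+2) zeta_partial (2 * j) K * zeta_partial (2 * (n.+2 - j)) K
     - (n%:R + 5 / 2) * zeta_partial (2 * n.+2) K|
  <= 2 * \sum_(1 <= k < K.+1) k%:R^-1 ^+ (2 * n.+1) * (K.+1 - k)%:R^-1.
Proof.
pose a k : F := k%:R^-1 ^+ 2.
pose T k m := \sum_(1 <= j < n.+2) a k ^+ j * a m ^+ (n.+2 - j).
pose w k m : F := (m%:R ^+ 2 - k%:R ^+ 2)^-1.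
have zE s : zeta_partial (2 * s) K = \sum_(1 <= k < K.+1) a k ^+ s.
  by apply: eq_bigr => k _; rewrite /a -exprM.
have -> : \sum_(1 <= j < n.+2) zeta_partial (2 * j) K * zeta_partial (2 * (n.+2 - j)) K
  = \sum_(1 <= k < K.+1) \sum_(1 <= m < K.+1) T k m.
  rewrite [RHS](eq_bigr (fun k => \sum_(1 <= j < n.+2) \sum_(1 <= m < K.+1)
     a k ^+ j * a m ^+ (n.+2 - j))); last by move=> k _; rewrite /T exchange_big.
  rewrite exchange_big; apply: eq_bigr => j _; rewrite !zE mulr_suml.
  by apply: eq_bigr => k _; rewrite mulr_sumr.
have -> : \sum_(1 <= k < K.+1) \sum_(1 <= m < K.+1) T k m
  = n.+1%:R * zeta_partial (2 * n.+2) K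
    + \sum_(1 <= k < K.+1) \sum_(1 <= m < K.+1 | m != k) T k m.
  rewrite zE mulr_sumr -big_split /=; apply: eq_big_nat => k /andP[k0 kK].
  rewrite (bigD1_seq k) /= ?mem_index_iota ?k0 ?iota_uniq //; congr (_ + _).
  rewrite /T (eq_big_nat _ _ (F2 := fun=> a k ^+ n.+2)).
    by rewrite sumr_const_nat subn1 /= mulr_natl.
  by move=> j /andP[_ jn]; rewrite -exprD subnKC // ltnW.
have -> : \sum_(1 <= k < K.+1) \sum_(1 <= m < K.+1 | m != k) T k m
  = 2 * \sum_(1 <= k < K.+1) a k ^+ n.+1 * \sum_(1 <= m < K.+1 | m != k) w k m.
  transitivity (\sum_(1 <= k < K.+1) \sum_(1 <= m < K.+1 | m != k) a k ^+ n.+1 * w k m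
    - \sum_(1 <= k < K.+1) \sum_(1 <= m < K.+1 | m != k) a m ^+ n.+1 * w k m).
    rewrite -sumrB; apply: eq_big_nat => k /andP[k0 _]; rewrite -sumrB.
    rewrite [LHS]big_nat_cond [RHS]big_nat_cond; apply: eq_bigr => m /andP[/andP[m0 _] mk].
    have a0 i : (0 < i)%N -> a i != 0 by move=> i0; rewrite expf_neq0 // invr_eq0 pnatr_eq0 -lt0n.
    rewrite /T geometric_difference ?a0 // /a -?exprVn ?invrK ?mulrBl //.
    by rewrite eqrXn2 ?invr_ge0 // (inj_eq invr_inj) eqr_nat eq_sym.
  have -> : \sum_(1 <= k < K.+1) \sum_(1 <= m < K.+1 | m != k) a m ^+ n.+1 * w k m
    = - \sum_(1 <= k < K.+1) \sum_(1 <= m < K.+1 | m != k) a k ^+ n.+1 * w k m.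
    rewrite (exchange_big_dep xpredT) //= -sumrN; apply: eq_bigr => m _.
    rewrite -sumrN; apply: eq_big => [k|k _]; first by rewrite eq_sym.
    by rewrite -(mulrN (a m ^+ n.+1)) /w -invrN opprB.
  rewrite opprK mulr_sumr -big_split; apply: eq_bigr => k _ /=.
  by rewrite -mulr_sumr; ring.
have -> : (n%:R + 5 / 2) * zeta_partial (2 * n.+2) K
  = n.+1%:R * zeta_partial (2 * n.+2) K
    + 2 * \sum_(1 <= k < K.+1) a k ^+ n.+1 * (3 / 4 * k%:R^-1 ^+ 2).
  have -> : \sum_(1 <= k < K.+1) a k ^+ n.+1 * (3 / 4 * k%:R^-1 ^+ 2)
     = 3 / 4 * zeta_partial (2 * n.+2) K.
    by rewrite zE mulr_sumr; apply: eq_bigr => k _; rewrite [in RHS]exprSr mulrCA.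
  by rewrite -[n.+1]addn1 natrD; field.
rewrite opprD addrACA subrr add0r -mulrBr normrM ger0_norm // ler_pM2l // -sumrB.
apply: le_trans (ler_norm_sum _ _ _) _.
rewrite [leLHS]big_nat_cond [leRHS]big_nat_cond; apply: ler_sum => k /andP[/andP[k0 kK] _].
rewrite -mulrBr normrM /a -exprM ger0_norm; last by rewrite exprn_ge0 // invr_ge0.
by rewrite ler_wpM2l ?exprn_ge0 ?invr_ge0 // sum_inv_sqr_diff // k0.
Qed.

(** Rests on [k (K + 1 - k) >= K]. *)
Lemma convolution_error_bound n K :
  \sum_(1 <= k < K.+1) k%:R^-1 ^+ (2 * n.+1) * (K.+1 - k)%:R^-1
  <= K%:R^-1 * \sum_(1 <= k < K.+1) k%:R^-1 :> F.
Proof.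
rewrite mulr_sumr [leLHS]big_nat_cond [leRHS]big_nat_cond.
apply: ler_sum => k /andP[/andP[k0 kK] _].
have ik0 : 0 <= k%:R^-1 :> F by rewrite invr_ge0.
have ik1 : k%:R^-1 <= 1 :> F by rewrite invf_le1 ?ler1n ?ltr0n.
have -> : (2 * n.+1 = (2 * n).+2)%N by lia.
rewrite !exprSr -mulrA [X in _ <= X]mulrC.
apply: (@le_trans _ _ (1 * k%:R^-1 * (k%:R^-1 * (K.+1 - k)%:R^-1))).
  rewrite !ler_wpM2r ?mulr_ge0 ?invr_ge0 //.
  by rewrite exprn_ile1.
rewrite mul1r ler_wpM2l // -invfM -natrM lef_pV2 ?posrE ?ltr0n.
- by rewrite ler_nat; nia.
- by rewrite muln_gt0 k0 subn_gt0.
- by lia.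
Qed.
End Zeta.

(** * Transfer to sequences of real numbers *)

Lemma sum_n_big (f : nat -> R) n : sum_n f n = \sum_(i < n.+1) f i.
Proof.
elim: n => [|n IHn]; first by rewrite sum_O big_ord_recl big_ord0 addr0.
by rewrite sum_Sn IHn [RHS]big_ord_recr.
Qed.

Lemma sum_f_R0_big (f : nat -> R) n : sum_f_R0 f n = \sum_(i < n.+1) f i.
Proof. by rewrite -sum_n_Reals sum_n_big. Qed.

(** Folds a range of even length about its middle. *)
Lemma sum_n_reflect (g : nat -> R) N :
  sum_n g (Nat.add N (S N))
  = sum_n (fun k => Rplus (g k) (g (Nat.sub (Nat.add N (S N)) k))) N.
Proof.
rewrite -[Nat.add N (S N)]/(N + N.+1)%N.
rewrite !sum_n_big -addSn big_split_ord /=.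
transitivity (\sum_(k < N.+1) (g k + g (N + N.+1 - k)%N)) => //.
rewrite big_split /=; congr (_ + _).
rewrite (reindex_inj rev_ord_inj) /=; apply: eq_bigr => i _; congr g.
by have := ltn_ord i; lia.
Qed.

Definition zeta_sum (s K : nat) : R := sum_n (fun k => Rinv (pow (INR (S k)) s)) K.

Lemma zeta_sumE s K : zeta_sum s K = zeta_partial _ s K.+1.
Proof.
rewrite /zeta_sum sum_n_big /zeta_partial big_add1 big_mkord; apply: eq_bigr => i _.
by rewrite RinvE RpowE INRE exprVn.
Qed.

Lemma zeta_sum_convolution n K :
  Rle (Rabs (Rminus
     (sum_n (fun j => Rmult (zeta_sum (2 * S j) K) (zeta_sum (2 * (S n - j)) K)) n)
     (Rmult (INR n + 5 / 2) (zeta_sum (2 * S (S n)) K))))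
   (Rmult (Rdiv 2 (INR (S K))) (zeta_sum 1 K)).
Proof.
apply/RleP; rewrite RabsE !zeta_sumE sum_n_big.
have H := @zeta_partial_convolution R n K.+1.
rewrite big_add1 big_mkord in H.
have B := @convolution_error_bound R n K.+1.
rewrite -(ler_pM2l (_ : 0 < 2)) // in B; move: (le_trans H B) => {H B} H.
have E2 : IZR 2 = 2 by rewrite -[LHS](INR_IZR_INZ 2) INRE.
have E5 : IZR 5 = 5 by rewrite -[LHS](INR_IZR_INZ 5) INRE.
rewrite RdivE RmultE RminusE RmultE RplusE RdivE !INRE E2 E5.
rewrite -mulrA.
have -> : zeta_partial R 1 K.+1 = \sum_(1 <= k < K.+2) k%:R^-1.
  by apply: eq_bigr => i _; rewrite expr1.
rewrite (eq_bigr (fun j : 'I_n.+1 => zeta_partial R (2 * j.+1) K.+1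
   * zeta_partial R (2 * (n.+2 - j.+1)) K.+1)) // => j _.
by rewrite !zeta_sumE.
Qed.

Lemma divisor_sigmaE s k : (0 < k)%N ->
  (divisor_sigma s k)%:R = \sum_(d <- divisors k) d%:R ^+ s :> R.
Proof.
move=> k0.
have list_sumE (t : list nat) : list_sum t = sumn t by elim: t => //= x t ->.
have filterE (p : nat -> bool) t : List.filter p t = [seq x <- t | p x].
  by elim: t => //= x t ->.
have mapE (f : nat -> nat) t : List.map f t = [seq f x | x <- t].
  by elim: t => //= x t ->.
have seqE a m : List.seq a m = iota a m by elim: m a => //= m IHm a; rewrite IHm.
rewrite /divisor_sigma list_sumE filterE mapE seqE sumnE big_map natr_sum.
transitivity (\sum_(d <- [seq x <- iota 1 k | (x %| k)%N]) d%:R ^+ s : R).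
  rewrite !big_filter big_seq_cond [RHS]big_seq_cond.
  apply: eq_big => [d|d _]; last first.
    by rewrite -natrX; congr _%:R; elim: s => //= s ->; rewrite expnS.
  case: (boolP (d \in iota 1 k)) => //=; rewrite mem_iota => /andP[d1 _].
  have -> : Nat.modulo k d = (k %% d)%N.
    symmetry; apply: (Nat.mod_unique _ _ (k %/ d)); first by apply/ssrnat.ltP; rewrite ltn_mod.
    by rewrite {1}(divn_eq k d) mulnC.
  by apply/Nat.eqb_spec/eqP.
apply: perm_big; apply: uniq_perm; rewrite ?filter_uniq ?iota_uniq ?divisors_uniq //.
move=> d; rewrite mem_filter mem_iota -dvdn_divisors //.
case: (boolP (d %| k)%N) => //= dk; rewrite (dvdn_gt0 k0 dk) add1n ltnS.
exact: dvdn_leq.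
Qed.

Lemma eqbE i j : Nat.eqb i j = (i == j).
Proof. by apply/Nat.eqb_spec/eqP. Qed.

Lemma lebE i j : Nat.leb i j = (i <= j)%N.
Proof. by apply/Nat.leb_spec0/ssrnat.leP. Qed.

Lemma eis_seqE b m l : eis_seq b m l = eis_coef b l m.
Proof.
rewrite /eis_seq /eis_coef !eqbE; rewrite !eqn0Ngt.
case: (posnP l) => // l0; case: (posnP m) => // m0; rewrite RmultE RdivE !INRE factE divisor_sigmaE //.
have -> : IZR 2 = 2 by rewrite -[LHS](INR_IZR_INZ 2) INRE.
by rewrite -subn1.
Qed.

Lemma coef_seqE b n j l : coef_seq b n j l = period_coef b n l j.
Proof.
rewrite /coef_seq /period_coef RminusE RoppE sum_f_R0_big RmultE RplusE.
congr (- _ - (_ + _) * _).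
- apply: eq_bigr => i _; rewrite RmultE !eis_seqE; congr (_ * eis_coef b _ _); lia.
- by rewrite /indicator eqbE; case: eqP.
- by rewrite /indicator eqbE; case: eqP.
rewrite /deriv_seq !RmultE RdivE !INRE factE.
have -> : IZR 2 = 2 by rewrite -[LHS](INR_IZR_INZ 2) INRE.
case: (posnP l) => [->|l0]; first by rewrite !mul0r.
by rewrite divisor_sigmaE // -subn1.
Qed.

Lemma binomialE n k : (k <= n)%N -> Binomial.C n k = 'C(n, k)%:R.
Proof.
move=> kn; rewrite /Binomial.C RdivE RmultE !INRE !factE -(bin_fact kn) !natrM.
have f0 := factr_neq0; field; rewrite !f0 //.
Qed.

Theorem coef_seq_relation (b : nat -> R) :
  b 0%N = Ropp 1 -> b 1%N = Ropp (Rinv 12) ->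
  (forall n, Rmult (2 * INR n + 5) (b (S (S n)))
     = sum_n (fun j => Rmult (b (S j)) (b (S n - j)%N)) n) ->
  forall n k l, le 1 n -> le 1 k -> le k (2 * n + 2) ->
  Rplus
   (sum_n (fun i => if Nat.leb (k - 1) (2 * i)
      then Rmult (Binomial.C (2 * i) (k - 1)) (coef_seq b n i l) else 0) (n + 1))
   (sum_n (fun i => if Nat.leb (2 * i) k
      then Rmult (Binomial.C (2 * n + 2 - 2 * i) (2 * n + 2 - k)) (coef_seq b n i l)
      else 0) (n + 1))
  = coef_seq b n (Nat.div k 2) l.
Proof.
move=> b0 b1 brec n k l /ssrnat.leP n0 /ssrnat.leP k0 /ssrnat.leP kn.
have b_quad j : (2 * j)%:R * b j
    = b j + \sum_(i < j.+1) b i * b (j - i)%N - (j == 1%N)%:R / 4.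
  have E12 : IZR 12 = 12 by rewrite -[LHS](INR_IZR_INZ 12) INRE.
  rewrite RoppE R1E in b0; rewrite RoppE RinvE E12 in b1.
  case: j => [|[|j]].
  - by rewrite big_ord_recl big_ord0 muln0 subn0 b0 /= !mul0r addr0 mulrN1 opprK addNr subr0.
  - by rewrite !big_ord_recl big_ord0 /= -[bump 0 0]/(1%N) subn0 subnn b0 b1 muln1; field.
  have := brec j; rewrite sum_n_big RmultE RplusE RmultE INRE.
  have -> : IZR 2 = 2 by rewrite -[LHS](INR_IZR_INZ 2) INRE.
  have -> : IZR 5 = 5 by rewrite -[LHS](INR_IZR_INZ 5) INRE.
  move=> E; rewrite big_ord_recl big_ord_recr /= subnn subn0 b0.
  rewrite (eq_bigr (fun i : 'I_j.+1 => Rmult (b (S i)) (b (S j - i)%N))) //.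
  have -> : (2 * j.+2)%:R = 2 * (j%:R + 2) :> R by rewrite natrM -[j.+2]addn2 natrD.
  by rewrite -E mul0r subr0 -[bump 0 j.+1]/(j.+2); ring.
rewrite !sum_n_big !addn1.
have -> : Nat.div k 2 = k./2.
  symmetry; apply: (Nat.div_unique _ _ _ (odd k)).
    by apply/ssrnat.ltP; case: (odd k).
  by rewrite -{1}(odd_double_half k) -mul2n addnC.
rewrite coef_seqE -(period_coef_relation _ b_quad) //; last by rewrite k0.
congr (_ + _); apply: eq_bigr => i _; rewrite lebE.
  rewrite -subn1; case: ifP => // H.
  by rewrite RmultE binomialE // coef_seqE.
case: ifP => // H; rewrite RmultE binomialE ?coef_seqE //.
by apply: leq_sub2l.
Qed.
End Identities.

Local Open Scope R_scope.

(** * Even zeta values *)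

(** The sums below are taken in an abstract monoid; the arithmetic tactics only
    recognise the addition of real numbers. *)
Ltac plus_to_Rplus :=
  repeat match goal with
  | |- context [@plus ?G ?a ?b] => change (@plus G a b) with (Rplus a b)
  end.

Lemma x_cos_le_sin (x : R) : 0 < x < PI / 2 -> x * cos x <= sin x.
Proof.
intros [H0 H1].
destruct (MVT_gen (fun t => sin t - t * cos t) 0 x (fun t => t * sin t)) as [c [Hc E]].
- intros t _; auto_derive; [exact I|ring].
- intros t _; reg.
- rewrite sin_0, Rmin_left, Rmax_right in *; try lra.
  assert (0 <= sin c) by (apply sin_ge_0; lra).
  assert (0 <= c * sin c * (x - 0)) by
    (apply Rmult_le_pos; [apply Rmult_le_pos|]; lra).
  lra.
Qed.

(** Equivalent to [sin x <= x <= tan x], because [1/sin^2 - 1 = 1/tan^2]. *)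
Lemma inv_sin_sqr_bounds (x : R) : 0 < x < PI / 2 ->
  / x ^ 2 <= / sin x ^ 2 <= / x ^ 2 + 1.
Proof.
intros H.
assert (Hs : 0 < sin x) by (apply sin_gt_0; lra).
assert (Hc : 0 < cos x) by (apply cos_gt_0; lra).
assert (H1 := sin_lt_x x (proj1 H)).
assert (H2 := x_cos_le_sin x H).
assert (Hx2 : 0 < x ^ 2) by (apply pow_lt; lra).
assert (Hs2 : 0 < sin x ^ 2) by (apply pow_lt; lra).
split.
- apply Rinv_le_contravar; [assumption|]. apply pow_incr; lra.
- assert (E : / sin x ^ 2 - 1 <= / x ^ 2).
  { replace (/ sin x ^ 2 - 1) with (cos x ^ 2 * / sin x ^ 2).
    - apply Rmult_le_reg_l with (sin x ^ 2 * x ^ 2); [nra|].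
      replace (sin x ^ 2 * x ^ 2 * (cos x ^ 2 * / sin x ^ 2)) with ((x * cos x) ^ 2)
        by (field; lra).
      replace (sin x ^ 2 * x ^ 2 * / x ^ 2) with (sin x ^ 2) by (field; lra).
      apply pow_incr; nra.
    - assert (E := sin2_cos2 x). unfold Rsqr in E.
      replace (cos x ^ 2) with (1 - sin x ^ 2) by lra.
      field; lra. }
  lra.
Qed.

(** The odd multiples of [PI / 2^(m+2)]; the first [2^m] of them are those below
    [PI / 2]. *)
Definition odd_angle (m k : nat) : R := (2 * INR k + 1) * PI / 2 ^ (m + 2).

Lemma odd_angle_range m k : (k < 2 ^ m)%nat -> 0 < odd_angle m k < PI / 2.
Proof.
intros H. assert (HP := PI_RGT_0). unfold odd_angle.
assert (H2 : 0 < 2 ^ (m + 2)) by (apply pow_lt; lra).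
assert (Hk := pos_INR k).
assert (HK : INR k + 1 <= 2 ^ m).
{ rewrite <- S_INR. replace (2 ^ m) with (INR (2 ^ m)%nat).
  - apply le_INR; lia.
  - rewrite pow_INR. reflexivity. }
assert (E2 : 2 ^ (m + 2) = 4 * 2 ^ m) by (rewrite pow_add; ring).
split.
- apply Rdiv_lt_0_compat; [apply Rmult_lt_0_compat|]; lra.
- apply Rmult_lt_reg_r with (2 ^ (m + 2)); [assumption|].
  replace ((2 * INR k + 1) * PI / 2 ^ (m + 2) * 2 ^ (m + 2)) with ((2 * INR k + 1) * PI)
    by (field; lra).
  rewrite E2. nra.
Qed.

(** The angles are symmetric about [PI/4], so those of level [m + 1] pair up as
    [t] and [PI/2 - t], and [1/sin^2 t + 1/cos^2 t = 4/sin^2(2t)] with [2t] an angle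
    of level [m]. *)
Lemma sum_inv_sin_sqr m :
  sum_n (fun k => / sin (odd_angle m k) ^ 2) (2 ^ m - 1) = 2 * 4 ^ m.
Proof.
induction m as [|m IH].
- rewrite sum_O. unfold odd_angle. simpl (2 ^ (0 + 2)).
  replace ((2 * INR 0 + 1) * PI / (2 * (2 * 1))) with (PI / 4) by (simpl; field).
  rewrite sin_PI4.
  assert (H2 : sqrt 2 <> 0) by (apply Rgt_not_eq, sqrt_lt_R0; lra).
  assert (Hs := pow2_sqrt 2 ltac:(lra)).
  replace (/ (1 / sqrt 2) ^ 2) with (sqrt 2 ^ 2) by (field; assumption).
  rewrite Hs. change (2 = 2 * 4 ^ 0 :> R); ring.
- assert (H1 : (1 <= 2 ^ m)%nat) by (clear; induction m; simpl; lia).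
  replace (2 ^ S m - 1)%nat with (2 ^ m - 1 + S (2 ^ m - 1))%nat by (simpl; lia).
  rewrite Identities.sum_n_reflect.
  transitivity (4 * sum_n (fun k => / sin (odd_angle m k) ^ 2) (2 ^ m - 1)).
  2: rewrite IH; simpl; ring.
  etransitivity; [|apply (sum_n_mult_l 4)].
  apply sum_n_ext_loc; intros k Hk.
  assert (Hr := odd_angle_range (S m) k ltac:(simpl; lia)).
  replace (odd_angle (S m) (_ - k)) with (PI / 2 - odd_angle (S m) k).
  + rewrite sin_shift.
    replace (odd_angle m k) with (2 * odd_angle (S m) k).
    * rewrite sin_2a. set (t := odd_angle (S m) k) in *.
      assert (0 < sin t) by (apply sin_gt_0; lra).
      assert (0 < cos t) by (apply cos_gt_0; lra).
      assert (E := sin2_cos2 t). unfold Rsqr in E.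
      unfold mult; simpl.
      replace (4 * / (2 * sin t * cos t * (2 * sin t * cos t * 1)))
        with ((sin t * sin t + cos t * cos t) / (sin t * sin t * (cos t * cos t))).
      -- field; lra.
      -- rewrite E. field; lra.
    * unfold odd_angle. simpl. field. apply pow_nonzero; lra.
  + unfold odd_angle.
    rewrite !minus_INR by lia. rewrite plus_INR, S_INR, minus_INR, pow_INR by lia.
    replace (S m + 2)%nat with (m + 3)%nat by lia. rewrite !pow_add. simpl.
    replace (1 + 1) with 2 by ring.    field. apply pow_nonzero; lra.
Qed.

Lemma is_lim_seq_pow2 (u : nat -> R) (l : Rbar) :
  is_lim_seq u l -> is_lim_seq (fun m => u (2 ^ m - 1)%nat) l.
Proof.
intros H. apply (is_lim_seq_subseq u l (fun m => 2 ^ m - 1)%nat); [|exact H].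
apply eventually_subseq. intros n.
assert (1 <= 2 ^ n)%nat by (induction n; simpl; lia).
simpl; lia.
Qed.

Lemma sum_n_le_loc (a b : nat -> R) n :
  (forall k, (k <= n)%nat -> a k <= b k) -> sum_n a n <= sum_n b n.
Proof.
induction n as [|n IH]; intros H.
- rewrite !sum_O; apply H; lia.
- rewrite !sum_Sn; apply Rplus_le_compat; [apply IH; intros; apply H|apply H]; lia.
Qed.

(** Replacing each [1/sin^2 t] by [1/t^2] in [sum_inv_sin_sqr] costs at most [1]
    per angle, that is [2^m] against a total of order [4^m]. *)
Lemma sum_inv_odd_sqr_dyadic :
  is_lim_seq (fun m => sum_n (fun k => / (2 * INR k + 1) ^ 2) (2 ^ m - 1)) (PI ^ 2 / 8).
Proof.
assert (HP := PI_RGT_0).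
set (S1 := fun m => sum_n (fun k => / (2 * INR k + 1) ^ 2) (2 ^ m - 1)).
assert (B : forall m, PI ^ 2 / 8 - PI ^ 2 / 16 * (/ 2) ^ m <= S1 m <= PI ^ 2 / 8).
{ intros m.
  assert (H1 : (1 <= 2 ^ m)%nat) by (induction m; simpl; lia).
  set (c := 16 * 4 ^ m / PI ^ 2).
  assert (H4 : 0 < 4 ^ m) by (apply pow_lt; lra).
  assert (H2 : 0 < 2 ^ m) by (apply pow_lt; lra).
  assert (Hc : 0 < c) by (apply Rdiv_lt_0_compat; nra).
  assert (E42 : 4 ^ m = 2 ^ m * 2 ^ m) by (rewrite <- Rpow_mult_distr; f_equal; lra).
  assert (E : c * S1 m = sum_n (fun k => / odd_angle m k ^ 2) (2 ^ m - 1)).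
  { symmetry. etransitivity; [|apply (sum_n_mult_l c)].
    apply sum_n_ext; intros k. unfold mult; simpl. unfold odd_angle, c.
    rewrite pow_add, E42. assert (Hk := pos_INR k). simpl. field. lra. }
  assert (L : c * S1 m <= 2 * 4 ^ m).
  { rewrite E, <- sum_inv_sin_sqr. apply sum_n_le_loc; intros k Hk.
    apply inv_sin_sqr_bounds, odd_angle_range; lia. }
  assert (U : 2 * 4 ^ m <= c * S1 m + 2 ^ m).
  { rewrite E, <- sum_inv_sin_sqr.
    replace (2 ^ m) with (sum_n (fun _ => 1) (2 ^ m - 1)).
    - change (sum_n (fun k => / sin (odd_angle m k) ^ 2) (2 ^ m - 1) <=
        plus (sum_n (fun k => / odd_angle m k ^ 2) (2 ^ m - 1)) (sum_n (fun _ => 1) (2 ^ m - 1))).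
      rewrite <- sum_n_plus. apply sum_n_le_loc; intros k Hk.
      apply inv_sin_sqr_bounds, odd_angle_range; lia.
    - rewrite sum_n_const. replace (S (2 ^ m - 1)) with (2 ^ m)%nat by lia.
      rewrite pow_INR, Rmult_1_r. reflexivity. }
  assert (E8 : c * (PI ^ 2 / 8) = 2 * 4 ^ m) by (unfold c; field; lra).
  assert (E16 : c * (PI ^ 2 / 16 * (/ 2) ^ m) = 2 ^ m).
  { unfold c. rewrite E42, pow_inv. field. lra. }
  split; apply Rmult_le_reg_l with c; lra. }
apply is_lim_seq_le_le with (1 := B).
- replace (PI ^ 2 / 8) with (PI ^ 2 / 8 - PI ^ 2 / 16 * 0) at 1 by ring.
  apply is_lim_seq_minus'; [apply is_lim_seq_const|].
  apply (is_lim_seq_scal_l (fun m => (/ 2) ^ m) (PI ^ 2 / 16) 0).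
  apply is_lim_seq_geom. rewrite Rabs_pos_eq; lra.
- apply is_lim_seq_const.
Qed.

(** Comparison with a telescoping series. *)
Lemma ex_series_inv_pow s : (2 <= s)%nat -> ex_series (fun k => / INR (S k) ^ s).
Proof.
intros Hs.
apply (ex_series_le (K := R_AbsRing) (V := R_CompleteNormedModule) _
  (fun k => 2 * (/ INR (S k) - / INR (S (S k))))).
- intros k. assert (Hk : 1 <= INR (S k)) by (rewrite S_INR; assert (Hk := pos_INR k); lra).
  change (Rabs (/ INR (S k) ^ s) <= 2 * (/ INR (S k) - / INR (S (S k)))).
  assert (Hp : 0 < INR (S k) ^ s) by (apply pow_lt; lra).
  rewrite Rabs_pos_eq by (left; apply Rinv_0_lt_compat; assumption).
  rewrite (S_INR (S k)). set (x := INR (S k)) in *.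
  apply Rle_trans with (/ x ^ 2).
  + apply Rinv_le_contravar; [apply pow_lt; lra|apply Rle_pow; [lra|lia]].
  + replace (2 * (/ x - / (x + 1))) with (/ (x * (x + 1) / 2)) by (field; lra).
    apply Rinv_le_contravar; nra.
- apply (ex_series_scal_l 2 (fun k => / INR (S k) - / INR (S (S k)))).
  exists (1 : R).
  change (is_lim_seq (sum_n (fun k => / INR (S k) - / INR (S (S k)))) 1).
  apply (is_lim_seq_ext (fun n => 1 - / INR (S (S n)))).
  + intros n; induction n as [|n IH].
    * rewrite sum_O. simpl. field.
    * rewrite sum_Sn, <- IH.
      change (1 - / INR (S (S (S n))) = 1 - / INR (S (S n))
        + (/ INR (S (S n)) - / INR (S (S (S n))))).
      ring.
  + replace 1 with (1 - 0) at 1 by ring.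
    apply is_lim_seq_minus'; [apply is_lim_seq_const|].
    apply (is_lim_seq_incr_1 (fun n => / INR (S n))).
    apply (is_lim_seq_incr_1 (fun n => / INR n)).
    apply (is_lim_seq_inv INR p_infty); [exact is_lim_seq_INR|discriminate].
Qed.

Lemma zeta_sum_lim s : (2 <= s)%nat -> is_lim_seq (Identities.zeta_sum s) (zeta s).
Proof. intros Hs. exact (Series_correct _ (ex_series_inv_pow s Hs)). Qed.

(** Splitting by parity: [zeta(2) = PI^2/8 + zeta(2)/4]. *)
Lemma zeta_2 : zeta 2 = PI ^ 2 / 6.
Proof.
set (odd := sum_n (fun k => / (2 * INR k + 1) ^ 2)).
assert (E : forall N, Identities.zeta_sum 2 (S (2 * N)) = odd N + / 4 * Identities.zeta_sum 2 N).
{ intros N; induction N as [|N IH]; unfold Identities.zeta_sum, odd in *.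
  - rewrite sum_Sn, !sum_O. change (plus (/ INR 1 ^ 2) (/ INR 2 ^ 2) = / (2 * INR 0 + 1) ^ 2 + / 4 * / INR 1 ^ 2).
    unfold plus; simpl. field.
  - replace (S (2 * S N)) with (S (S (S (2 * N)))) by lia.
    rewrite 2!sum_Sn, IH, !sum_Sn; plus_to_Rplus.
    replace (INR (S (S (S (2 * N))))) with (2 * INR (S N) + 1)
      by (rewrite !S_INR, mult_INR; simpl; ring).
    replace (INR (S (S (S (S (2 * N)))))) with (2 * INR (S (S N)))
      by (rewrite !S_INR, mult_INR; simpl; ring).
    assert (H := pos_INR (S N)). rewrite (S_INR (S N)). field. lra. }
assert (L1 : is_lim_seq (fun m => odd (2 ^ m - 1)%nat + / 4 * Identities.zeta_sum 2 (2 ^ m - 1))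
  (PI ^ 2 / 8 + / 4 * zeta 2)).
{ apply is_lim_seq_plus'; [exact sum_inv_odd_sqr_dyadic|].
  apply (is_lim_seq_scal_l _ (/ 4) (zeta 2)).
  apply (is_lim_seq_pow2 (Identities.zeta_sum 2)), zeta_sum_lim. lia. }
assert (L2 : is_lim_seq (fun m => odd (2 ^ m - 1)%nat + / 4 * Identities.zeta_sum 2 (2 ^ m - 1))
  (zeta 2)).
{ apply (is_lim_seq_ext (fun m => Identities.zeta_sum 2 (2 ^ (S m) - 1))).
  - intros m. rewrite <- E. f_equal.
    assert (1 <= 2 ^ m)%nat by (clear; induction m; simpl; lia). simpl; lia.
  - apply (is_lim_seq_incr_1 (fun m => Identities.zeta_sum 2 (2 ^ m - 1))).
    apply (is_lim_seq_pow2 (Identities.zeta_sum 2)), zeta_sum_lim. lia. }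
assert (U := is_lim_seq_unique _ _ L1).
rewrite (is_lim_seq_unique _ _ L2) in U. injection U. lra.
Qed.

Lemma harmonic_sqrt_bound K : Identities.zeta_sum 1 K <= 2 * sqrt (INR (S K)).
Proof.
induction K as [|K IH]; unfold Identities.zeta_sum in *.
- rewrite sum_O. simpl. rewrite sqrt_1. lra.
- rewrite sum_Sn. apply Rle_trans with (2 * sqrt (INR (S K)) + / INR (S (S K)) ^ 1).
  + apply Rplus_le_compat_r. exact IH.
  + rewrite pow_1, (S_INR (S K)).
    assert (Hx : 1 <= INR (S K)) by (rewrite S_INR; assert (H := pos_INR K); lra).
    set (x := INR (S K)) in *.
    assert (H0 := sqrt_sqrt x ltac:(lra)). assert (H1 := sqrt_sqrt (x + 1) ltac:(lra)).
    assert (P0 : 0 < sqrt x) by (apply sqrt_lt_R0; lra).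
    assert (P1 : sqrt x < sqrt (x + 1)) by (apply sqrt_lt_1; lra).
    set (a := sqrt x) in *. set (c := sqrt (x + 1)) in *.
    assert (c1 : 1 <= c) by nra.
    apply Rmult_le_reg_r with (x + 1); [lra|].
    rewrite Rmult_plus_distr_r, Rinv_l by lra.
    assert (1 = (c - a) * (c + a)) by lra.
    assert (0 <= (c - a) * (2 * (x + 1) - (c + a))) by (apply Rmult_le_pos; nra).
    lra.
Qed.

(** Euler's formula, the limit of [zeta_partial_convolution]: the error is at most
    [2/K] times a harmonic number, and harmonic numbers grow slower than [K]. *)
Lemma zeta_convolution n :
  sum_n (fun j => zeta (2 * S j) * zeta (2 * (S n - j))) n
  = (INR n + 5 / 2) * zeta (2 * S (S n)).
Proof.
set (u := fun K => sum_n (fun j => Identities.zeta_sum (2 * S j) K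
   * Identities.zeta_sum (2 * (S n - j)) K) n - (INR n + 5 / 2) * Identities.zeta_sum (2 * S (S n)) K).
assert (L0 : is_lim_seq u 0).
{ apply is_lim_seq_abs_0.
  apply is_lim_seq_le_le with (fun _ => 0) (fun K => 4 * / sqrt (INR (S K))).
  - intros K. split; [apply Rabs_pos|].
    eapply Rle_trans; [apply Identities.zeta_sum_convolution|].
    assert (HK : 0 < INR (S K)) by (apply lt_0_INR; lia).
    apply Rle_trans with (2 / INR (S K) * (2 * sqrt (INR (S K)))).
    + apply Rmult_le_compat_l; [|apply harmonic_sqrt_bound].
      left; apply Rdiv_lt_0_compat; lra.
    + right. assert (H := sqrt_sqrt (INR (S K)) ltac:(lra)).
      assert (Hs := sqrt_lt_R0 _ HK).
      rewrite <- H at 1. field. lra.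
  - apply is_lim_seq_const.
  - replace (Finite 0) with (Rbar_mult 4 0) by (simpl; f_equal; ring).
    apply is_lim_seq_scal_l.
    apply (is_lim_seq_inv (fun K => sqrt (INR (S K))) p_infty); [|discriminate].
    apply (filterlim_comp _ _ _ (fun K => INR (S K)) sqrt eventually (Rbar_locally p_infty)).
    + apply (is_lim_seq_incr_1 INR p_infty). exact is_lim_seq_INR.
    + exact filterlim_sqrt_p. }
assert (L1 : is_lim_seq u (sum_n (fun j => zeta (2 * S j) * zeta (2 * (S n - j))) n
   - (INR n + 5 / 2) * zeta (2 * S (S n)))).
{ apply is_lim_seq_minus'.
  - assert (G : forall m, (m <= n)%nat -> is_lim_seq
      (fun K => sum_n (fun j => Identities.zeta_sum (2 * S j) K
         * Identities.zeta_sum (2 * (S n - j)) K) m)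
      (sum_n (fun j => zeta (2 * S j) * zeta (2 * (S n - j))) m)).
    { induction m as [|m IH]; intros Hm.
      - rewrite sum_O. apply is_lim_seq_ext with (fun K => Identities.zeta_sum (2 * S 0) K
         * Identities.zeta_sum (2 * (S n - 0)) K).
        + intros K. now rewrite sum_O.
        + apply is_lim_seq_mult'; apply zeta_sum_lim; lia.
      - rewrite sum_Sn.
        apply is_lim_seq_ext with (fun K => sum_n (fun j => Identities.zeta_sum (2 * S j) K
         * Identities.zeta_sum (2 * (S n - j)) K) m + Identities.zeta_sum (2 * S (S m)) K
         * Identities.zeta_sum (2 * (S n - S m)) K).
        + intros K. now rewrite sum_Sn.
        + apply is_lim_seq_plus'; [apply IH; lia|].
          apply is_lim_seq_mult'; apply zeta_sum_lim; lia. }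
    apply G; lia.
  - apply (is_lim_seq_scal_l _ (INR n + 5 / 2) (zeta (2 * S (S n)))).
    apply zeta_sum_lim; lia. }
assert (U := is_lim_seq_unique _ _ L1).
rewrite (is_lim_seq_unique _ _ L0) in U. injection U; intros V.
apply Rminus_diag_uniq. symmetry. exact V.
Qed.

(** [2 zeta(2j) / (2 pi i)^(2j)], extended to [j = 0] by the value that
    [zeta(0) = -1/2] would give. *)
Definition zeta_coef (j : nat) : R :=
  if Nat.eqb j 0 then -1 else 2 * zeta (2 * j) * (-1) ^ j / (2 * PI) ^ (2 * j).

Lemma zeta_coef_1 : zeta_coef 1 = - / 12.
Proof.
assert (HP := PI_RGT_0).
unfold zeta_coef; simpl Nat.eqb; cbv iota. replace (2 * 1)%nat with 2%nat by lia.
rewrite zeta_2. field. lra.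
Qed.

Lemma zeta_coef_convolution n :
  (2 * INR n + 5) * zeta_coef (S (S n))
  = sum_n (fun j => zeta_coef (S j) * zeta_coef (S n - j)) n.
Proof.
assert (HP := PI_RGT_0).
set (c := 4 * (-1) ^ S (S n) / (2 * PI) ^ (2 * S (S n))).
transitivity (c * sum_n (fun j => zeta (2 * S j) * zeta (2 * (S n - j))) n).
- rewrite zeta_convolution. unfold zeta_coef, c; simpl Nat.eqb; cbv iota.
  field. apply pow_nonzero; lra.
- symmetry. etransitivity; [|apply (sum_n_mult_l c)].
  apply sum_n_ext_loc; intros j Hj. unfold zeta_coef.
  replace (Nat.eqb (S n - j) 0) with false by (symmetry; apply Nat.eqb_neq; lia).
  simpl Nat.eqb; cbv iota. unfold c.
  replace (S (S n)) with (S j + (S n - j))%nat by lia.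
  rewrite Nat.mul_add_distr_l, !pow_add.
  match goal with |- @eq _ ?a (@mult _ ?b ?d) => change (a = b * d) end.
  field. split; apply pow_nonzero; lra.
Qed.

(** * Term-by-term differentiation and growth *)

Lemma sin_Lipschitz x y : Rabs (sin y - sin x) <= Rabs (y - x).
Proof.
destruct (MVT_gen sin x y cos) as [c [_ E]].
- intros t _; auto_derive; [exact I|ring].
- intros t _; reg.
- rewrite E, Rabs_mult. rewrite <- (Rmult_1_l (Rabs (y - x))) at 2.
  apply Rmult_le_compat_r; [apply Rabs_pos|]. apply Rabs_le, COS_bound.
Qed.

Lemma cos_Lipschitz x y : Rabs (cos y - cos x) <= Rabs (y - x).
Proof.
rewrite !cos_sin. replace (y - x) with (PI / 2 + y - (PI / 2 + x)) by ring.
apply sin_Lipschitz.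
Qed.

Lemma quadratic_Taylor_bound (g g' : R -> R) :
  (forall x, is_derive g x (g' x)) ->
  (forall x y, Rabs (g' y - g' x) <= Rabs (y - x)) ->
  forall x y, Rabs (g y - g x - (y - x) * g' x) <= (y - x) ^ 2.
Proof.
intros Hg HL x y.
destruct (MVT_gen g x y g') as [c [Hc E]].
- intros t _; apply Hg.
- intros t _; apply continuity_pt_filterlim, (ex_derive_continuous g).
  exists (g' t). apply Hg.
- rewrite E. replace (g' c * (y - x) - (y - x) * g' x) with ((g' c - g' x) * (y - x)) by ring.
  rewrite Rabs_mult. replace ((y - x) ^ 2) with (Rabs (y - x) * Rabs (y - x))
    by (rewrite <- Rabs_mult, Rabs_pos_eq; [ring|apply Rle_0_sqr]).
  apply Rmult_le_compat_r; [apply Rabs_pos|].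
  eapply Rle_trans; [apply HL|].
  unfold Rmin, Rmax in Hc. destruct (Rle_dec x y).
  + rewrite !Rabs_pos_eq; lra.
  + rewrite !Rabs_left1; lra.
Qed.

Lemma ex_series_abs_le (a b : nat -> R) :
  (forall k, Rabs (a k) <= b k) -> ex_series b -> ex_series a.
Proof. exact (ex_series_le (K := R_AbsRing) (V := R_CompleteNormedModule) a b). Qed.

(** Differentiation term by term without uniform convergence of derivatives: the
    remainder of the [k]-th term is at most [(w k (t - x))^2 |c_k|], so the total
    remainder is quadratic in [t - x].  Stated for a pair [g, g'] to serve both
    [cos] and [sin]. *)
Lemma is_derive_frequency_series (g g' : R -> R) (c : nat -> R) (w x : R) :
  (forall t, is_derive g t (g' t)) ->
  (forall t u, Rabs (g' u - g' t) <= Rabs (u - t)) ->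
  (forall t, Rabs (g t) <= 1) -> (forall t, Rabs (g' t) <= 1) ->
  ex_series (fun k => Rabs (c k) * INR (S k) ^ 2) ->
  is_derive (fun t => Series (fun k => c k * g (w * INR k * t))) x
    (w * Series (fun k => INR k * c k * g' (w * INR k * x))).
Proof.
intros Hg HL Bg Bg' Hc.
assert (Hk : forall k, 0 <= INR k /\ INR k <= INR (S k) ^ 2 /\ 1 <= INR (S k) ^ 2).
{ intros k. assert (H := pos_INR k). rewrite S_INR. nra. }
assert (E0 : forall t, ex_series (fun k => c k * g (w * INR k * t))).
{ intros t. apply ex_series_abs_le with (2 := Hc). intros k. rewrite Rabs_mult.
  apply Rmult_le_compat_l; [apply Rabs_pos|].
  eapply Rle_trans; [apply Bg|apply Hk]. }
assert (E1 : ex_series (fun k => INR k * c k * g' (w * INR k * x))).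
{ apply ex_series_abs_le with (2 := Hc). intros k. destruct (Hk k) as [H1 [H2 H3]].
  rewrite !Rabs_mult, (Rabs_pos_eq (INR k)) by assumption.
  assert (H4 := Bg' (w * INR k * x)). assert (H5 := Rabs_pos (c k)).
  assert (H6 := Rabs_pos (g' (w * INR k * x))).
  apply Rle_trans with (INR k * Rabs (c k) * 1); [apply Rmult_le_compat_l; nra|nra]. }
set (M := w ^ 2 * Series (fun k => Rabs (c k) * INR (S k) ^ 2)).
set (T := fun t => Series (fun k => c k * g (w * INR k * t))).
set (T' := w * Series (fun k => INR k * c k * g' (w * INR k * x))).
assert (B : forall t, Rabs (T t - T x - (t - x) * T') <= M * (t - x) ^ 2).
{ intros t. set (d := fun k => c k * (g (w * INR k * t) - g (w * INR k * x)
    - (w * INR k * t - w * INR k * x) * g' (w * INR k * x))).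
  assert (Ed : T t - T x - (t - x) * T' = Series d).
  { unfold T, T'. rewrite <- Rmult_assoc, <- Series_scal_l.
    rewrite <- Series_minus, <- Series_minus; auto.
    - apply Series_ext; intros k. unfold d. ring.
    - apply (ex_series_minus (fun k => c k * g (w * INR k * t))); auto.
    - apply (ex_series_scal_l ((t - x) * w)
        (fun k => INR k * c k * g' (w * INR k * x))). exact E1. }
  rewrite Ed.
  assert (Bd : forall k, Rabs (d k) <= (w * (t - x)) ^ 2 * (Rabs (c k) * INR (S k) ^ 2)).
  { intros k. unfold d. rewrite Rabs_mult.
    assert (H := quadratic_Taylor_bound g g' Hg HL (w * INR k * x) (w * INR k * t)).
    apply Rle_trans with (Rabs (c k) * (w * INR k * t - w * INR k * x) ^ 2).
    - apply Rmult_le_compat_l; [apply Rabs_pos|exact H].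
    - replace ((w * INR k * t - w * INR k * x) ^ 2) with ((w * (t - x)) ^ 2 * INR k ^ 2) by ring.
      assert (H5 := Rabs_pos (c k)). assert (H6 := pow2_ge_0 (w * (t - x))).
      assert (INR k ^ 2 <= INR (S k) ^ 2) by (apply pow_incr; rewrite S_INR; assert (H7 := pos_INR k); lra).
      replace (Rabs (c k) * ((w * (t - x)) ^ 2 * INR k ^ 2)) with
        ((w * (t - x)) ^ 2 * (Rabs (c k) * INR k ^ 2)) by ring.
      apply Rmult_le_compat_l; [assumption|]. apply Rmult_le_compat_l; assumption. }
  assert (Ex : ex_series (fun k => (w * (t - x)) ^ 2 * (Rabs (c k) * INR (S k) ^ 2)))
    by (apply (ex_series_scal_l ((w * (t - x)) ^ 2) (fun k => Rabs (c k) * INR (S k) ^ 2)); exact Hc).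
  eapply Rle_trans; [apply Series_Rabs|].
  - apply ex_series_abs_le with (2 := Ex). intros k. rewrite Rabs_Rabsolu. apply Bd.
  - eapply Rle_trans; [apply Series_le with (2 := Ex)|].
    + intros k; split; [apply Rabs_pos|apply Bd].
    + rewrite Series_scal_l. unfold M. right; ring. }
apply is_derive_Reals. intros eps Heps.
assert (HM : 0 <= M).
{ unfold M. apply Rmult_le_pos; [apply pow2_ge_0|].
  rewrite <- (Rmult_0_l (Series (fun k => Rabs (c k) * INR (S k) ^ 2))), <- Series_scal_l.
  apply Series_le with (2 := Hc). intros k; split; [lra|].
  assert (H1 := Rabs_pos (c k)). assert (H2 := pow2_ge_0 (INR (S k))). nra. }
assert (Hd : 0 < eps / (M + 1)) by (apply Rdiv_lt_0_compat; lra).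
exists (mkposreal _ Hd). intros h h0 Hh. simpl in Hh.
specialize (B (x + h)). replace (x + h - x) with h in B by ring.
fold (T (x + h)) (T x) T'.
replace ((T (x + h) - T x) / h - T') with ((T (x + h) - T x - h * T') / h) by (field; assumption).
unfold Rdiv at 1. rewrite Rabs_mult, Rabs_inv.
assert (Ah : 0 < Rabs h) by (apply Rabs_pos_lt; assumption).
apply Rle_lt_trans with (M * h ^ 2 * / Rabs h).
- apply Rmult_le_compat_r; [left; apply Rinv_0_lt_compat|]; assumption.
- rewrite <- (pow2_abs h). replace (M * Rabs h ^ 2 * / Rabs h) with (M * Rabs h) by (field; lra).
  apply Rle_lt_trans with ((M + 1) * Rabs h); [nra|].
  apply Rmult_lt_reg_r with (/ (M + 1)); [apply Rinv_0_lt_compat; lra|].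
  replace ((M + 1) * Rabs h * / (M + 1)) with (Rabs h) by (field; lra). exact Hh.
Qed.

Lemma ex_series_poly_geom (a : nat -> R) (M r : R) (p : nat) :
  0 < r < 1 -> (forall k, Rabs (a k) <= M * INR (S k) ^ p) ->
  ex_series (fun k => Rabs (a k) * r ^ k).
Proof.
intros Hr Ha.
assert (E : ex_series (fun k => Rabs (INR (S k) ^ p * r ^ k))).
{ apply ex_series_DAlembert with r; [lra| |].
  - intros k. apply Rmult_integral_contrapositive_currified; apply pow_nonzero; [|lra].
    apply not_0_INR; lia.
  - apply is_lim_seq_ext with (fun k => (1 + / INR (S k)) ^ p * r).
    + intros k. assert (Hk : 0 < INR (S k)) by (apply lt_0_INR; lia).
      assert (H1 := pow_lt _ p Hk). assert (H2 := pow_lt r k (proj1 Hr)).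
      rewrite Rabs_pos_eq.
      * replace (1 + / INR (S k)) with (INR (S (S k)) / INR (S k))
          by (rewrite (S_INR (S k)); field; lra).
        unfold Rdiv at 1. rewrite Rpow_mult_distr, pow_inv. simpl (r ^ S k). field; lra.
      * left. apply Rdiv_lt_0_compat; apply Rmult_lt_0_compat; auto; apply pow_lt; try lra.
        apply lt_0_INR; lia.
    + replace (Finite r) with (Finite ((1 + 0) ^ p * r))
        by (f_equal; rewrite Rplus_0_r, pow1; ring).
      apply (is_lim_seq_continuous (fun t => (1 + t) ^ p * r) (fun k => / INR (S k)) 0).
      * reg.
      * apply (is_lim_seq_incr_1 (fun n => / INR n)).
        apply (is_lim_seq_inv INR p_infty); [exact is_lim_seq_INR|discriminate]. }
apply ex_series_abs_le with (fun k => M * Rabs (INR (S k) ^ p * r ^ k)).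
- intros k. assert (H2 := pow_lt r k (proj1 Hr)).
  rewrite Rabs_mult, Rabs_Rabsolu, (Rabs_pos_eq (r ^ k)) by lra.
  rewrite (Rabs_pos_eq (INR (S k) ^ p * r ^ k))
    by (apply Rmult_le_pos; [apply pow_le, pos_INR|lra]).
  rewrite <- Rmult_assoc. apply Rmult_le_compat_r; [lra|apply Ha].
- apply (ex_series_scal_l M (fun k => Rabs (INR (S k) ^ p * r ^ k))). exact E.
Qed.

Lemma divisor_sigma_bound s k : INR (divisor_sigma s k) <= INR k ^ S s.
Proof.
assert (B : (divisor_sigma s k <= k ^ S s)%nat).
{ unfold divisor_sigma.
  assert (G : forall l, (forall d, In d l -> (d <= k)%nat) ->
    (list_sum (map (fun d => Nat.pow d s) l) <= length l * k ^ s)%nat).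
  { induction l as [|d l IH]; intros H; [simpl; lia|].
    assert (H1 : (d ^ s <= k ^ s)%nat) by (apply Nat.pow_le_mono_l, H; left; reflexivity).
    assert (H2 : (list_sum (map (fun d => Nat.pow d s) l) <= length l * k ^ s)%nat)
      by (apply IH; intros e He; apply H; right; exact He).
    simpl; lia. }
  eapply Nat.le_trans; [apply G|].
  - intros d Hd. apply filter_In in Hd as [Hd _]. apply in_seq in Hd. lia.
  - change (k ^ S s)%nat with (k * k ^ s)%nat. apply Nat.mul_le_mono_r.
    eapply Nat.le_trans; [apply filter_length_le|]. rewrite length_seq. lia. }
rewrite <- pow_INR. apply le_INR, B.
Qed.

(** * Evaluation of q-series *)

(** Series lemmas leave equations whose type is a structure over the reals. *)
Ltac real_eq := match goal with |- @eq _ ?x ?y => change (@eq R x y) end.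

Definition qpow (tau : C) (k : nat) : C :=
  Cexp (2 * RtoC PI * Ci * RtoC (INR k) * tau)%C.

Definition qnorm (tau : C) : R := exp (- (2 * PI * Im tau)).

Definition qeval (a : nat -> R) (tau : C) : C :=
  CSeries (fun k => RtoC (a k) * qpow tau k)%C.

(** Absolute convergence of [sum_k a_k q^k], where [|q|] is [qnorm tau]. *)
Definition summable (tau : C) (a : nat -> R) : Prop :=
  ex_series (fun k => Rabs (a k) * qnorm tau ^ k).

Lemma qnorm_range tau : 0 < Im tau -> 0 < qnorm tau < 1.
Proof.
intros H. assert (HP := PI_RGT_0). split; [apply exp_pos|].
unfold qnorm. rewrite <- exp_0. apply exp_increasing. nra.
Qed.

Lemma qpow_polar tau k : qpow tau k =
  (qnorm tau ^ k * cos (2 * PI * INR k * Re tau),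
   qnorm tau ^ k * sin (2 * PI * INR k * Re tau)).
Proof.
unfold qpow, Cexp, qnorm.
assert (E : exp (- (2 * PI * Im tau)) ^ k = exp (- (2 * PI * INR k * Im tau))).
{ induction k as [|k IH].
  - simpl. rewrite Rmult_0_r, Rmult_0_l, Ropp_0, exp_0. reflexivity.
  - rewrite <- tech_pow_Rmult, IH, <- exp_plus, S_INR. f_equal; ring. }
rewrite E. destruct tau as [x y]; unfold Re, Im; simpl.
f_equal; f_equal; f_equal; ring.
Qed.

Lemma qpow_0 tau : qpow tau 0 = RtoC 1.
Proof.
rewrite qpow_polar. simpl INR. rewrite Rmult_0_r, Rmult_0_l, cos_0, sin_0.
unfold RtoC; f_equal; simpl; ring.
Qed.

Lemma qpow_add tau i j : qpow tau (i + j) = (qpow tau i * qpow tau j)%C.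
Proof.
rewrite !qpow_polar, plus_INR, Rmult_plus_distr_l, Rmult_plus_distr_r.
rewrite cos_plus, sin_plus, pow_add. unfold Cmult; simpl. f_equal; ring.
Qed.

Lemma qpow_Re_bound tau k : 0 < Im tau -> Rabs (Re (qpow tau k)) <= qnorm tau ^ k.
Proof.
intros H. rewrite qpow_polar; unfold Re at 1; simpl.
assert (P := pow_lt _ k (proj1 (qnorm_range tau H))).
rewrite Rabs_mult, (Rabs_pos_eq (qnorm tau ^ k)) by lra.
rewrite <- (Rmult_1_r (qnorm tau ^ k)) at 2. apply Rmult_le_compat_l; [lra|].
apply Rabs_le, COS_bound.
Qed.

Lemma qpow_Im_bound tau k : 0 < Im tau -> Rabs (Im (qpow tau k)) <= qnorm tau ^ k.
Proof.
intros H. rewrite qpow_polar; unfold Im at 1; simpl.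
assert (P := pow_lt _ k (proj1 (qnorm_range tau H))).
rewrite Rabs_mult, (Rabs_pos_eq (qnorm tau ^ k)) by lra.
rewrite <- (Rmult_1_r (qnorm tau ^ k)) at 2. apply Rmult_le_compat_l; [lra|].
apply Rabs_le, SIN_bound.
Qed.

Lemma summable_component tau a (p : nat -> R) :
  summable tau a -> (forall k, Rabs (p k) <= qnorm tau ^ k) ->
  ex_series (fun k => a k * p k) /\ ex_series (fun k => Rabs (a k * p k)).
Proof.
intros Ha Hp.
assert (B : forall k, Rabs (a k * p k) <= Rabs (a k) * qnorm tau ^ k).
{ intros k. rewrite Rabs_mult. apply Rmult_le_compat_l; [apply Rabs_pos|apply Hp]. }
split; apply ex_series_abs_le with (2 := Ha); intros k; rewrite ?Rabs_Rabsolu; apply B.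
Qed.

Lemma Re_RtoC_mult (r : R) (z : C) : Re (RtoC r * z)%C = r * Re z.
Proof. destruct z as [x y]. unfold Re; simpl. ring. Qed.

Lemma Im_RtoC_mult (r : R) (z : C) : Im (RtoC r * z)%C = r * Im z.
Proof. destruct z as [x y]. unfold Im; simpl. ring. Qed.

Lemma qeval_components a tau : qeval a tau =
  (Series (fun k => a k * Re (qpow tau k)), Series (fun k => a k * Im (qpow tau k))).
Proof.
unfold qeval, CSeries; f_equal; apply Series_ext; intros k;
  [apply Re_RtoC_mult|apply Im_RtoC_mult].
Qed.

Lemma qeval_ext a b tau : (forall k, a k = b k) -> qeval a tau = qeval b tau.
Proof.
intros H; rewrite !qeval_components; f_equal; apply Series_ext; intros k; now rewrite H.
Qed.

Lemma qeval_scal c a tau : qeval (fun k => c * a k) tau = (RtoC c * qeval a tau)%C.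
Proof.
rewrite !qeval_components.
rewrite (Series_ext _ (fun k => c * (a k * Re (qpow tau k)))) by (intros; ring).
rewrite (Series_ext (fun k => c * a k * Im (qpow tau k)) (fun k => c * (a k * Im (qpow tau k))))
  by (intros; ring).
rewrite !Series_scal_l. unfold Cmult; simpl. f_equal; ring.
Qed.

Section Fixed.
Variable tau : C.
Hypothesis Htau : 0 < Im tau.

Lemma summable_scal c a : summable tau a -> summable tau (fun k => c * a k).
Proof.
intros H. apply ex_series_ext with (fun k => Rabs c * (Rabs (a k) * qnorm tau ^ k)).
- intros k. real_eq. rewrite Rabs_mult. ring.
- apply (ex_series_scal_l (Rabs c) (fun k => Rabs (a k) * qnorm tau ^ k)). exact H.
Qed.

Lemma summable_plus a b :
  summable tau a -> summable tau b -> summable tau (fun k => a k + b k).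
Proof.
intros Ha Hb. apply ex_series_abs_le with
  (fun k => Rabs (a k) * qnorm tau ^ k + Rabs (b k) * qnorm tau ^ k).
- intros k. assert (P := pow_lt _ k (proj1 (qnorm_range tau Htau))).
  rewrite Rabs_mult, Rabs_Rabsolu, (Rabs_pos_eq (qnorm tau ^ k)) by lra.
  rewrite <- Rmult_plus_distr_r. apply Rmult_le_compat_r; [lra|apply Rabs_triang].
- apply (ex_series_plus (fun k => Rabs (a k) * qnorm tau ^ k)); assumption.
Qed.

Lemma summable_Re a : summable tau a -> ex_series (fun k => a k * Re (qpow tau k)).
Proof.
intros Ha. apply (summable_component tau a _ Ha (fun k => qpow_Re_bound tau k Htau)).
Qed.

Lemma summable_Im a : summable tau a -> ex_series (fun k => a k * Im (qpow tau k)).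
Proof.
intros Ha. apply (summable_component tau a _ Ha (fun k => qpow_Im_bound tau k Htau)).
Qed.

Lemma qeval_plus a b : summable tau a -> summable tau b ->
  qeval (fun k => a k + b k) tau = (qeval a tau + qeval b tau)%C.
Proof.
intros Ha Hb. rewrite !qeval_components.
rewrite (Series_ext _ (fun k => a k * Re (qpow tau k) + b k * Re (qpow tau k)))
  by (intros; ring).
rewrite (Series_ext (fun k => (a k + b k) * Im (qpow tau k))
  (fun k => a k * Im (qpow tau k) + b k * Im (qpow tau k))) by (intros; ring).
rewrite !Series_plus by auto using summable_Re, summable_Im. reflexivity.
Qed.

Definition conv (a b : nat -> R) (l : nat) : R :=
  sum_f_R0 (fun i => a i * b (l - i)%nat) l.

Lemma summable_conv a b :
  summable tau a -> summable tau b -> summable tau (conv a b).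
Proof.
intros Ha Hb. assert (Pos := proj1 (qnorm_range tau Htau)).
set (a' := fun k => Rabs (a k) * qnorm tau ^ k).
set (b' := fun k => Rabs (b k) * qnorm tau ^ k).
assert (Pa : forall (c : nat -> R) k, Rabs (Rabs (c k) * qnorm tau ^ k) = Rabs (c k) * qnorm tau ^ k).
{ intros c k. apply Rabs_pos_eq, Rmult_le_pos; [apply Rabs_pos|apply pow_le; lra]. }
assert (M := is_series_mult a' b' _ _ (Series_correct _ Ha) (Series_correct _ Hb)).
apply ex_series_abs_le with (conv a' b').
- intros l. rewrite Pa. unfold conv.
  apply Rle_trans with (sum_f_R0 (fun i => Rabs (a i * b (l - i)%nat)) l * qnorm tau ^ l).
  + apply Rmult_le_compat_r; [apply pow_le; lra|apply Rsum_abs].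
  + right. rewrite Rmult_comm, scal_sum. apply sum_eq; intros i Hi.
    unfold a', b'. rewrite Rabs_mult.
    replace (qnorm tau ^ l) with (qnorm tau ^ i * qnorm tau ^ (l - i))
      by (rewrite <- pow_add; f_equal; lia).
    ring.
- eexists. apply M.
  + eapply ex_series_ext; [|exact Ha]. intros k. symmetry. apply Pa.
  + eapply ex_series_ext; [|exact Hb]. intros k. symmetry. apply Pa.
Qed.

(** Cauchy's product theorem, applied to the four products of real and imaginary
    parts and recombined through [q^l = q^i q^(l-i)]. *)
Lemma qeval_conv a b : summable tau a -> summable tau b ->
  qeval (conv a b) tau = (qeval a tau * qeval b tau)%C.
Proof.
intros Ha Hb.
assert (C : forall c, summable tau c ->
  (is_series (fun k => c k * Re (qpow tau k)) (Series (fun k => c k * Re (qpow tau k)))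
   /\ ex_series (fun k => Rabs (c k * Re (qpow tau k))))
  /\ is_series (fun k => c k * Im (qpow tau k)) (Series (fun k => c k * Im (qpow tau k)))
   /\ ex_series (fun k => Rabs (c k * Im (qpow tau k)))).
{ intros c Hc. repeat split.
  - apply Series_correct, summable_Re, Hc.
  - apply (summable_component tau c _ Hc (fun k => qpow_Re_bound tau k Htau)).
  - apply Series_correct, summable_Im, Hc.
  - apply (summable_component tau c _ Hc (fun k => qpow_Im_bound tau k Htau)). }
destruct (C a Ha) as [[ar1 ar2] [ai1 ai2]], (C b Hb) as [[br1 br2] [bi1 bi2]].
assert (RR := is_series_mult _ _ _ _ ar1 br1 ar2 br2).
assert (II := is_series_mult _ _ _ _ ai1 bi1 ai2 bi2).
assert (RI := is_series_mult _ _ _ _ ar1 bi1 ar2 bi2).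
assert (IR := is_series_mult _ _ _ _ ai1 br1 ai2 br2).
rewrite !qeval_components. unfold Cmult; cbn [fst snd]. f_equal.
- apply is_series_unique.
  eapply is_series_ext; [|exact (is_series_minus _ _ _ _ RR II)].
  intros l. change (minus ?x ?y) with (x - y). real_eq.
  etransitivity; [symmetry; apply minus_sum|].
  unfold conv. rewrite (Rmult_comm (sum_f_R0 _ l)), scal_sum.
  apply sum_eq; intros i Hi.
  assert (Q : qpow tau l = (qpow tau i * qpow tau (l - i))%C)
    by (rewrite <- qpow_add; f_equal; lia).
  rewrite Q.
  change (Re (?x * ?y)%C) with (Re x * Re y - Im x * Im y). ring.
- apply is_series_unique.
  eapply is_series_ext; [|exact (is_series_plus _ _ _ _ RI IR)].
  intros l. change (plus ?x ?y) with (x + y). real_eq.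
  etransitivity; [symmetry; apply plus_sum|].
  unfold conv. rewrite (Rmult_comm (sum_f_R0 _ l)), scal_sum.
  apply sum_eq; intros i Hi.
  assert (Q : qpow tau l = (qpow tau i * qpow tau (l - i))%C)
    by (rewrite <- qpow_add; f_equal; lia).
  rewrite Q.
  change (Im (?x * ?y)%C) with (Re x * Im y + Im x * Re y). ring.
Qed.

Lemma qeval_sum_n (a : nat -> nat -> R) n :
  (forall i, (i <= n)%nat -> summable tau (a i)) ->
  summable tau (fun l => sum_n (fun i => a i l) n) /\
  qeval (fun l => sum_n (fun i => a i l) n) tau = sum_n (fun i => qeval (a i) tau) n.
Proof.
induction n as [|n IH]; intros H.
- split; [|rewrite sum_O; apply qeval_ext; intros; now rewrite sum_O].
  eapply ex_series_ext; [|exact (H 0%nat (le_n 0))]. intros k. now rewrite sum_O.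
- destruct IH as [Hs E]; [intros; apply H; lia|].
  assert (HS : summable tau (a (S n))) by (apply H; lia).
  split.
  + eapply ex_series_ext; [|exact (summable_plus _ _ Hs HS)].
    intros k. now rewrite sum_Sn.
  + rewrite sum_Sn, <- E. change (plus ?x ?y) with (x + y)%C.
    rewrite <- qeval_plus by assumption. apply qeval_ext; intros k. now rewrite sum_Sn.
Qed.
End Fixed.

Lemma eis_seq_bound b m k : Rabs (eis_seq b m k)
  <= (Rabs (b m) + 2 / INR (fact (2 * m - 1))) * INR (S k) ^ S (2 * m - 1).
Proof.
unfold eis_seq.
assert (Hf : 0 < 2 / INR (fact (2 * m - 1))).
{ apply Rdiv_lt_0_compat; [lra|]. apply lt_0_INR, lt_O_fact. }
assert (Hb := Rabs_pos (b m)).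
assert (Hk : 1 <= INR (S k) ^ S (2 * m - 1)).
{ apply pow_R1_Rle. rewrite S_INR. assert (P := pos_INR k). lra. }
destruct (Nat.eqb k 0); [nra|]. destruct (Nat.eqb m 0).
- rewrite Rabs_R0. nra.
- assert (B := divisor_sigma_bound (2 * m - 1) k).
  assert (P := pos_INR (divisor_sigma (2 * m - 1) k)).
  rewrite Rabs_pos_eq by nra.
  assert (INR k ^ S (2 * m - 1) <= INR (S k) ^ S (2 * m - 1)).
  { apply pow_incr; split; [apply pos_INR|apply le_INR; lia]. }
  nra.
Qed.

Lemma summable_eis_seq b m tau : 0 < Im tau -> summable tau (eis_seq b m).
Proof.
intros H. apply ex_series_poly_geom with (2 := eis_seq_bound b m). exact (qnorm_range tau H).
Qed.

Lemma summable_deriv_seq n tau : 0 < Im tau -> summable tau (deriv_seq n).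
Proof.
intros H.
apply ex_series_poly_geom with (M := 2 / INR (fact (2 * n)))
  (p := S (S (2 * n - 1))); [exact (qnorm_range tau H)|].
intros k. unfold deriv_seq.
assert (Hf : 0 < 2 / INR (fact (2 * n))).
{ apply Rdiv_lt_0_compat; [lra|]. apply lt_0_INR, lt_O_fact. }
assert (B := divisor_sigma_bound (2 * n - 1) k).
assert (P := pos_INR (divisor_sigma (2 * n - 1) k)). assert (Pk := pos_INR k).
assert (P2 : 0 <= INR k * INR (divisor_sigma (2 * n - 1) k)) by (apply Rmult_le_pos; assumption).
rewrite Rabs_pos_eq by (apply Rmult_le_pos; lra).
apply Rmult_le_compat_l; [lra|].
apply Rle_trans with (INR k ^ S (S (2 * n - 1))).
- rewrite <- tech_pow_Rmult. apply Rmult_le_compat_l; assumption.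
- apply pow_incr; split; [apply pos_INR|apply le_INR; lia].
Qed.

Lemma two_pi_i_pow m :
  ((2 * RtoC PI * Ci) ^ (2 * m))%C = RtoC ((2 * PI) ^ (2 * m) * (-1) ^ m).
Proof.
assert (E : ((2 * RtoC PI * Ci) ^ 2)%C = RtoC (- (2 * PI) ^ 2)).
{ unfold RtoC, Ci, Cmult; simpl. unfold Cmult; simpl. f_equal; ring. }
induction m as [|m IH].
- simpl. unfold RtoC; f_equal; ring.
- replace (2 * S m)%nat with (2 + 2 * m)%nat by lia.
  rewrite Cpow_add_r, E, IH, <- RtoC_mult. f_equal. rewrite pow_add. simpl. ring.
Qed.

Lemma eisenstein_qeval m tau : (1 <= m)%nat -> 0 < Im tau ->
  eisenstein m tau = ((2 * RtoC PI * Ci) ^ (2 * m) * qeval (eis_seq zeta_coef m) tau)%C.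
Proof.
intros Hm H. assert (HP := PI_RGT_0).
set (W := ((2 * RtoC PI * Ci) ^ (2 * m))%C).
set (f := 2 / INR (fact (2 * m - 1))).
set (sg := fun k => INR (divisor_sigma (2 * m - 1) (S k))).
set (T := CSeries (fun k => RtoC (sg k) * qpow tau (S k))%C).
assert (E : qeval (eis_seq zeta_coef m) tau = (RtoC (zeta_coef m) + RtoC f * T)%C).
{ rewrite qeval_components.
  assert (Hs := summable_eis_seq zeta_coef m tau H).
  rewrite Series_incr_1 by (apply summable_Re; assumption).
  rewrite (Series_incr_1 (fun k => eis_seq zeta_coef m k * Im (qpow tau k)))
    by (apply summable_Im; assumption).
  rewrite qpow_0.
  assert (ES : forall k, eis_seq zeta_coef m (S k) = f * sg k).
  { intros k. unfold eis_seq. simpl Nat.eqb; cbv iota.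
    replace (Nat.eqb m 0) with false by (symmetry; apply Nat.eqb_neq; lia). reflexivity. }
  rewrite (Series_ext (fun k => _ * Re (qpow tau (S k)))
     (fun k => f * Re (RtoC (sg k) * qpow tau (S k))%C))
    by (intros k; rewrite ES, Re_RtoC_mult; ring).
  rewrite (Series_ext (fun k => _ * Im (qpow tau (S k)))
     (fun k => f * Im (RtoC (sg k) * qpow tau (S k))%C))
    by (intros k; rewrite ES, Im_RtoC_mult; ring).
  rewrite !Series_scal_l. unfold T, CSeries, eis_seq; simpl Nat.eqb; cbv iota.
  unfold RtoC, Cplus, Cmult; simpl. f_equal; ring. }
rewrite E. unfold eisenstein. fold W.
change (CSeries _) with T.
assert (EW : (W * RtoC (zeta_coef m))%C = RtoC (2 * zeta (2 * m))).
{ unfold W. rewrite two_pi_i_pow, <- RtoC_mult. f_equal. unfold zeta_coef.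
  replace (Nat.eqb m 0) with false by (symmetry; apply Nat.eqb_neq; lia).
  assert (E1 : (-1) ^ m * (-1) ^ m = 1) by (rewrite <- Rpow_mult_distr; replace (-1 * -1) with 1 by ring; apply pow1).
  replace ((2 * PI) ^ (2 * m) * (-1) ^ m * (2 * zeta (2 * m) * (-1) ^ m / (2 * PI) ^ (2 * m)))
    with (2 * zeta (2 * m) * ((-1) ^ m * (-1) ^ m)) by (field; apply pow_nonzero; lra).
  rewrite E1. ring. }
rewrite Cmult_plus_distr_l, EW. f_equal.
unfold f. rewrite RtoC_div.
- unfold Cdiv. ring.
- apply not_0_INR, fact_neq_0.
Qed.

(** * The derivative of an Eisenstein series *)

Lemma Lim_difference_quotient (f g : R -> R) (x d : R) :
  is_derive f x d -> (forall t, t <> x -> g t = (f t - f x) / (t - x)) ->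
  real (Lim g x) = d.
Proof.
intros Hf Hg. rewrite (is_lim_unique g x d); [reflexivity|].
apply is_lim_spec. intros eps.
apply is_derive_Reals in Hf. destruct (Hf eps (cond_pos eps)) as [del Hdel].
exists del. intros t Ht Hne. rewrite Hg by assumption.
specialize (Hdel (t - x)).
assert (Et : forall u v : R, u + (v - u) = v) by (intros; ring).
rewrite Et in Hdel.
apply Hdel; [exact (Rminus_eq_contra _ _ Hne)|exact Ht].
Qed.

Lemma Cdiv_RtoC (u : C) (h : R) : h <> 0 -> (u / RtoC h)%C = (fst u / h, snd u / h).
Proof. intros Hh. unfold Cdiv, Cinv, Cmult; simpl. f_equal; field; lra. Qed.

(** The increments of the variable are real, so the complex difference quotient
    splits into two real ones. *)
Lemma C_derive_horizontal (f : C -> C) (tau d : C) :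
  is_derive (fun x => fst (f (x, snd tau))) (fst tau) (fst d) ->
  is_derive (fun x => snd (f (x, snd tau))) (fst tau) (snd d) ->
  C_derive f tau = d.
Proof.
intros H1 H2. destruct tau as [x y], d as [d1 d2]. cbn [fst snd] in *.
unfold C_derive, C_lim. cbn [fst snd].
assert (E : forall t, t <> x -> ((f (t, y) - f (x, y)) / ((t, y) - (x, y)))%C
  = ((fst (f (t, y)) - fst (f (x, y))) / (t - x),
     (snd (f (t, y)) - snd (f (x, y))) / (t - x))).
{ intros t Ht. replace ((t, y) - (x, y))%C with (RtoC (t - x)).
  - rewrite Cdiv_RtoC by lra. reflexivity.
  - unfold RtoC, Cminus, Cplus, Copp; simpl. f_equal; ring. }
f_equal.
- apply (Lim_difference_quotient (fun t => fst (f (t, y)))); [exact H1|].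
  intros t Ht. now rewrite E.
- apply (Lim_difference_quotient (fun t => snd (f (t, y)))); [exact H2|].
  intros t Ht. now rewrite E.
Qed.

Lemma eis_seq_weighted_summable b m tau : 0 < Im tau ->
  ex_series (fun k => Rabs (eis_seq b m k * qnorm tau ^ k) * INR (S k) ^ 2).
Proof.
intros H. assert (Pos := proj1 (qnorm_range tau H)).
set (M := Rabs (b m) + 2 / INR (fact (2 * m - 1))).
apply ex_series_ext with
  (fun k => Rabs (eis_seq b m k * INR (S k) ^ 2) * qnorm tau ^ k).
- intros k. real_eq. rewrite !Rabs_mult, (Rabs_pos_eq (qnorm tau ^ k)) by (apply pow_le; lra).
  rewrite (Rabs_pos_eq (INR (S k) ^ 2)) by apply pow2_ge_0. ring.
- apply ex_series_poly_geom with (M := M) (p := (S (2 * m - 1) + 2)%nat);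
    [exact (qnorm_range tau H)|].
  intros k. rewrite Rabs_mult, (Rabs_pos_eq (INR (S k) ^ 2)) by apply pow2_ge_0.
  rewrite pow_add, <- Rmult_assoc. apply Rmult_le_compat_r; [apply pow2_ge_0|].
  apply eis_seq_bound.
Qed.

(** On a horizontal line [|q|] is constant and [q^k] only rotates, so the two
    components are trigonometric series; their derivatives recombine into
    [2 pi i sum_k k a_k q^k]. *)
Lemma qeval_horizontal_derive (a : nat -> R) (tau : C) : 0 < Im tau ->
  ex_series (fun k => Rabs (a k * qnorm tau ^ k) * INR (S k) ^ 2) ->
  let d := (2 * RtoC PI * Ci * qeval (fun k => INR k * a k)%R tau)%C in
  is_derive (fun x => fst (qeval a (x, snd tau))) (fst tau) (fst d)
  /\ is_derive (fun x => snd (qeval a (x, snd tau))) (fst tau) (snd d).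
Proof.
intros H Ha d. destruct tau as [x y]; cbn [fst snd] in *.
set (c := fun k => a k * qnorm (x, y) ^ k) in Ha.
assert (Dcos := is_derive_frequency_series cos (fun t => - sin t) c (2 * PI) x).
assert (Dsin := is_derive_frequency_series sin cos c (2 * PI) x).
assert (Ed : d = (2 * PI * Series (fun k => INR k * c k * - sin (2 * PI * INR k * x)),
                  2 * PI * Series (fun k => INR k * c k * cos (2 * PI * INR k * x)))).
{ unfold d. rewrite qeval_components.
  rewrite (Series_ext (fun k => INR k * a k * Re _) (fun k => INR k * c k * cos (2 * PI * INR k * x)))
    by (intros k; rewrite qpow_polar; unfold c, Re; simpl; ring).
  rewrite (Series_ext (fun k => INR k * a k * Im _)
     (fun k => - 1 * (INR k * c k * - sin (2 * PI * INR k * x))))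
    by (intros k; rewrite qpow_polar; unfold c, Re, Im; simpl; ring).
  rewrite Series_scal_l. unfold Cmult, Ci, RtoC; simpl. f_equal; ring. }
rewrite Ed; cbn [fst snd]. split.
- eapply is_derive_ext; [|apply Dcos].
  + intros t. rewrite qeval_components; cbn [fst]. apply Series_ext; intros k.
    rewrite qpow_polar. unfold c, Re; cbn [fst]. change (qnorm (t, y)) with (qnorm (x, y)). ring.
  + intros t. auto_derive; [exact I|ring].
  + intros t u. replace (- sin u - - sin t) with (- (sin u - sin t)) by ring.
    rewrite Rabs_Ropp. apply sin_Lipschitz.
  + intros t. apply Rabs_le, COS_bound.
  + intros t. rewrite Rabs_Ropp. apply Rabs_le, SIN_bound.
  + exact Ha.
- eapply is_derive_ext; [|apply Dsin].
  + intros t. rewrite qeval_components; cbn [snd]. apply Series_ext; intros k.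
    rewrite qpow_polar. unfold c, Re, Im; cbn [fst snd]. change (qnorm (t, y)) with (qnorm (x, y)). ring.
  + intros t. auto_derive; [exact I|ring].
  + apply cos_Lipschitz.
  + intros t. apply Rabs_le, SIN_bound.
  + intros t. apply Rabs_le, COS_bound.
  + exact Ha.
Qed.

Lemma eisenstein_derive n tau : (1 <= n)%nat -> 0 < Im tau ->
  C_derive (eisenstein n) tau =
  ((2 * RtoC PI * Ci) ^ (2 * n) * (2 * RtoC PI * Ci * (2 * RtoC (INR n) * qeval (deriv_seq n) tau)))%C.
Proof.
intros Hn H.
set (W := ((2 * RtoC PI * Ci) ^ (2 * n))%C).
set (a := eis_seq zeta_coef n).
assert (Ed : (2 * RtoC (INR n) * qeval (deriv_seq n) tau)%C = qeval (fun k => INR k * a k) tau).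
{ rewrite <- RtoC_mult, <- qeval_scal. apply qeval_ext; intros k.
  unfold a, eis_seq, deriv_seq. destruct k as [|k]; [simpl; ring|].
  simpl Nat.eqb; cbv iota. replace (Nat.eqb n 0) with false by (symmetry; apply Nat.eqb_neq; lia).
  assert (Ef : INR (fact (2 * n)) = 2 * INR n * INR (fact (2 * n - 1))).
  { replace (2 * n)%nat with (S (2 * n - 1)) at 1 by lia.
    rewrite fact_simpl, mult_INR. replace (S (2 * n - 1)) with (2 * n)%nat by lia.
    rewrite mult_INR. reflexivity. }
  rewrite Ef. assert (Hf := INR_fact_neq_0 (2 * n - 1)).
  assert (INR n <> 0) by (apply not_0_INR; lia). field. split; assumption. }
rewrite Ed.
destruct (qeval_horizontal_derive a tau H (eis_seq_weighted_summable _ _ _ H)) as [D1 D2].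
set (d := (2 * RtoC PI * Ci * qeval (fun k => INR k * a k)%R tau)%C) in *.
assert (E : forall x, eisenstein n (x, snd tau) = (W * qeval a (x, snd tau))%C).
{ intros x. apply eisenstein_qeval; [assumption|exact H]. }
apply C_derive_horizontal.
- apply (is_derive_ext (fun x => fst W * fst (qeval a (x, snd tau)) - snd W * snd (qeval a (x, snd tau)))).
  + intros t. rewrite E. reflexivity.
  + apply (is_derive_minus (V := R_NormedModule)); apply is_derive_scal; assumption.
- apply (is_derive_ext (fun x => fst W * snd (qeval a (x, snd tau)) + snd W * fst (qeval a (x, snd tau)))).
  + intros t. rewrite E. reflexivity.
  + apply (is_derive_plus (V := R_NormedModule)); apply is_derive_scal; assumption.
Qed.

(** * The coefficients as q-series and the theorem *)

Lemma qeval_zero tau : qeval (fun _ => 0) tau = RtoC 0.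
Proof.
rewrite (qeval_ext _ (fun k => 0 * 0)) by (intros; ring).
rewrite qeval_scal. unfold Cmult, RtoC; simpl. f_equal; ring.
Qed.

Lemma qeval_eis_seq_0 tau : 0 < Im tau ->
  qeval (eis_seq zeta_coef 0) tau = RtoC (-1).
Proof.
intros H. rewrite qeval_components.
assert (Hs := summable_eis_seq zeta_coef 0 tau H).
rewrite Series_incr_1 by (apply summable_Re; assumption).
rewrite (Series_incr_1 (fun k => eis_seq zeta_coef 0 k * Im (qpow tau k)))
  by (apply summable_Im; assumption).
rewrite qpow_0.
rewrite (Series_ext (fun k => _ * Re (qpow tau (S k))) (fun k => 0 * 0))
  by (intros k; unfold eis_seq; simpl; ring).
rewrite (Series_ext (fun k => _ * Im (qpow tau (S k))) (fun k => 0 * 0))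
  by (intros k; unfold eis_seq; simpl; ring).
rewrite Series_scal_l. unfold eis_seq, zeta_coef, RtoC; simpl. f_equal; ring.
Qed.

Lemma summable_coef_seq n j tau : 0 < Im tau -> summable tau (coef_seq zeta_coef n j).
Proof.
intros H.
apply ex_series_ext with (fun l => Rabs (-1 * conv (eis_seq zeta_coef j)
  (eis_seq zeta_coef (n + 1 - j)) l + (- (indicator j 1 + indicator j n)) * deriv_seq n l) * qnorm tau ^ l).
- intros l. real_eq. f_equal. f_equal. unfold coef_seq, conv. ring.
- apply summable_plus; [assumption| |].
  + apply summable_scal, summable_conv; [assumption|..]; apply summable_eis_seq; assumption.
  + apply summable_scal, summable_deriv_seq, H.
Qed.

(** A convolution of q-coefficients evaluates to the product of the Eisenstein
    series. *)
Lemma qeval_coef_seq n j tau : 0 < Im tau ->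
  qeval (coef_seq zeta_coef n j) tau =
  (- (qeval (eis_seq zeta_coef j) tau * qeval (eis_seq zeta_coef (n + 1 - j)) tau)
   - (kronecker j 1 + kronecker j n) * qeval (deriv_seq n) tau)%C.
Proof.
intros H.
rewrite (qeval_ext _ (fun l => -1 * conv (eis_seq zeta_coef j)
  (eis_seq zeta_coef (n + 1 - j)) l + (- (indicator j 1 + indicator j n)) * deriv_seq n l))
  by (intros l; unfold coef_seq, conv; ring).
assert (S1 := summable_eis_seq zeta_coef j tau H).
assert (S2 := summable_eis_seq zeta_coef (n + 1 - j) tau H).
rewrite qeval_plus; [|assumption|..].
- rewrite !qeval_scal, qeval_conv by assumption.
  assert (K : forall i l, kronecker i l = RtoC (indicator i l))
    by (intros i l; unfold kronecker, indicator; destruct (Nat.eqb i l); reflexivity).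
  rewrite !K, <- RtoC_plus, RtoC_opp.
  replace (RtoC (-1)) with (- RtoC 1)%C by (rewrite <- RtoC_opp; f_equal; ring).
  ring.
- apply summable_scal, summable_conv; assumption.
- apply summable_scal, summable_deriv_seq, H.
Qed.

(** For [j = 0] and [j = n + 1] the product contains [e_0 = -1] and the Kronecker
    terms vanish, so the three cases of the definition agree. *)
Lemma coef_qeval n j tau : (1 <= n)%nat -> (j <= n + 1)%nat -> 0 < Im tau ->
  coef n tau j =
  ((2 * RtoC PI * Ci) ^ (2 * n + 2) * qeval (coef_seq zeta_coef n j) tau)%C.
Proof.
intros Hn Hj H. rewrite qeval_coef_seq by assumption. unfold coef.
assert (K : forall i l, i <> l -> kronecker i l = RtoC 0).
{ intros i l Hil. unfold kronecker. apply Nat.eqb_neq in Hil. now rewrite Hil. }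
assert (Em : RtoC (-1) = (- RtoC 1)%C) by (rewrite <- RtoC_opp; f_equal; ring).
destruct (Nat.eqb_spec j 0) as [->|H0]; [|destruct (Nat.eqb_spec j (n + 1)) as [->|H1]];
  cbn [orb].
- rewrite qeval_eis_seq_0, !K, eisenstein_qeval by (assumption || lia).
  replace (n + 1 - 0)%nat with (n + 1)%nat by lia.
  replace (2 * (n + 1))%nat with (2 * n + 2)%nat by lia. rewrite Em. ring.
- replace (n + 1 - (n + 1))%nat with 0%nat by lia.
  rewrite qeval_eis_seq_0, !K, eisenstein_qeval by (assumption || lia).
  replace (2 * (n + 1))%nat with (2 * n + 2)%nat by lia. rewrite Em. ring.
- rewrite eisenstein_derive, !eisenstein_qeval by (assumption || lia).
  set (w := (2 * RtoC PI * Ci)%C).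
  assert (E1 : (w ^ (2 * n + 2) = w ^ (2 * j) * w ^ (2 * (n + 1 - j)))%C)
    by (rewrite <- Cpow_add_r; f_equal; lia).
  assert (E2 : (w ^ (2 * n + 2) = w ^ (2 * n) * (w * w))%C)
    by (rewrite Cpow_add_r; simpl; ring).
  assert (Hn0 : RtoC (INR n) <> RtoC 0)
    by (intros E; apply RtoC_inj in E; revert E; apply not_0_INR; lia).
  assert (E3 : (RtoC PI * Ci / RtoC (INR n) * (w ^ (2 * n)
      * (w * (2 * RtoC (INR n) * qeval (deriv_seq n) tau)))
    = w ^ (2 * n + 2) * qeval (deriv_seq n) tau)%C).
  { rewrite E2. unfold w. field. exact Hn0. }
  rewrite <- (Cmult_assoc (kronecker j 1 + kronecker j n)), E3, E1. ring.
Qed.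

Local Open Scope C_scope.

Theorem theorem7p1 (n k : nat) (tau : C)
  (hn : (1 <= n)%nat) (hk1 : (1 <= k)%nat) (hk2 : (k <= 2 * n + 2)%nat)
  (htau : (0 < Im tau)%R) :
  sum_n (fun i : nat =>
           if Nat.leb (k - 1) (2 * i)
           then binom (2 * i) (k - 1) * coef n tau i else RtoC 0) (n + 1)
  + sum_n (fun i : nat =>
             if Nat.leb (2 * i) k
             then binom (2 * n + 2 - 2 * i) (2 * n + 2 - k) * coef n tau i
             else RtoC 0) (n + 1)
  = if Nat.odd k then coef n tau ((k - 1) / 2)%nat else coef n tau (k / 2)%nat.
Proof.
set (W := (2 * RtoC PI * Ci) ^ (2 * n + 2)).
set (s := coef_seq zeta_coef n).
assert (Term : forall (P : nat -> bool) (B : nat -> R),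
  sum_n (fun i => if P i then RtoC (B i) * coef n tau i else RtoC 0) (n + 1)
  = W * qeval (fun l => sum_n (fun i => if P i then B i * s i l else 0)%R (n + 1)) tau
  /\ summable tau (fun l => sum_n (fun i => if P i then B i * s i l else 0)%R (n + 1))).
{ intros P B.
  destruct (qeval_sum_n tau htau (fun i l => if P i then B i * s i l else 0)%R (n + 1)) as [Hs E].
  - intros i _. destruct (P i).
    + apply summable_scal, summable_coef_seq, htau.
    + apply (ex_series_ext (fun l => Rabs (0 * s i l) * qnorm tau ^ l)%R).
      * intros l. real_eq. f_equal. f_equal. ring.
      * apply (summable_scal tau 0%R), summable_coef_seq, htau.
  - cbv beta in Hs, E. split; [|exact Hs].
    etransitivity; [|symmetry; exact (f_equal (Cmult W) E)].
    etransitivity; [|exact (sum_n_mult_l (K := C_Ring) W _ _)].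
    apply sum_n_ext_loc; intros i Hi. destruct (P i).
    + rewrite coef_qeval, qeval_scal by assumption. fold W s.
      match goal with |- @eq _ ?x ?y => change (@eq C x y) end.
      unfold mult; simpl. ring.
    + rewrite qeval_zero. match goal with |- @eq _ ?x ?y => change (@eq C x y) end.
      unfold mult; simpl. ring. }
destruct (Term (fun i => Nat.leb (k - 1) (2 * i)) (fun i => Binomial.C (2 * i) (k - 1))) as [E1 S1].
destruct (Term (fun i => Nat.leb (2 * i) k)
  (fun i => Binomial.C (2 * n + 2 - 2 * i) (2 * n + 2 - k))) as [E2 S2].
unfold binom. cbv beta in E1, E2. rewrite E1, E2, <- Cmult_plus_distr_l, <- qeval_plus by assumption.
transitivity (coef n tau (k / 2)).
- rewrite coef_qeval by (try assumption; apply Nat.Div0.div_le_upper_bound; lia).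
  fold W s. f_equal. apply qeval_ext; intros l.
  apply (Identities.coef_seq_relation (b := zeta_coef)); try assumption.
  + reflexivity.
  + exact zeta_coef_1.
  + exact zeta_coef_convolution.
- destruct (Nat.odd k) eqn:Ho; [|reflexivity]. f_equal.
  apply Nat.odd_spec in Ho. destruct Ho as [m ->].
  replace (2 * m + 1 - 1)%nat with (m * 2)%nat by lia.
  replace (2 * m + 1)%nat with (1 + m * 2)%nat by lia.
  rewrite Nat.div_add, Nat.div_mul by lia. reflexivity.
Qed.
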